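(* Let $d\ge 1$, let $\Xi=\Upsilon\subset\mathbb{R}^d$ be a (nonempty) open, bounded and connected set, let $\Omega=\Xi-\Upsilon=\{x-y: x\in\Xi,\ y\in\Upsilon\}$, and let $f\in L^2(\Omega)$. Then the operator $\Theta_f:L^2(\Upsilon)\to L^2(\Xi)$ is positive semidefinite and has finite rank $K$ if and only if there exist distinct $\xi_1,\ldots,\xi_K\in\mathbb{R}^d$ and $c_1,\ldots,c_K>0$ such that $$f(x)=\sum_{k=1}^K c_k e^{i\,\xi_k\cdot x}$$ (as elements of $L^2(\Omega)$).
   Context: Functions are complex valued. The truncated convolution operator $\Theta_f:L^2(\Upsilon)\to L^2(\Xi)$ is defined by $$\Theta_f(g)(x)=\int_{\Upsilon} f(x-y)g(y)\,dy,\qquad x\in\Xi.$$ For $a,b\in\mathbb{C}^d$, $a\cdot b=\sum_{m=1}^d a_m b_m$. An operator $A$ on $L^2(\Xi)$ is positive semidefinite (PSD) if $\langle A g,g\rangle\ge 0$ for all $g\in L^2(\Xi)$. The rank of an operator is the dimension of its range. *)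

(* Defs.v *)
From HB Require Import structures.
From mathcomp Require Import all_boot all_order all_algebra.
From mathcomp Require Import all_classical all_reals all_analysis measurable_realfun.
From mathcomp Require Import complex.

Set Implicit Arguments.
Unset Strict Implicit.
Unset Printing Implicit Defensive.

Import Order.TTheory GRing.Theory Num.Theory.
Import numFieldTopology.Exports numFieldNormedType.Exports.

Local Open Scope classical_set_scope.
Local Open Scope ring_scope.
Local Open Scope complex_scope.

Section borel_rV.
Variables (R : realType) (n : nat).

(* 'rV[R]_n carries its Borel sigma-algebra. Completing it would not change the
   spaces L^2: a Lebesgue-measurable function is a.e. equal to a Borel one. *)
HB.instance Definition _ :=
  @isMeasurable.Build (sigma_display (@open 'rV[R]_n)) 'rV[R]_n
    <<s @open 'rV[R]_n >> (@sigma_algebra0 _ setT _)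
    (@sigma_algebraC _ _) (@sigma_algebra_bigcup _ setT _).

Lemma open_measurable_rV (A : set 'rV[R]_n) : open A -> measurable A.
Proof. exact: sub_sigma_algebra. Qed.

Lemma measurable_rV d (T : measurableType d) (D : set T) (f : T -> 'rV[R]_n) :
  (forall i, measurable_fun D (fun x => f x 0 i : R)) -> measurable_fun D f.
Proof.
move=> mf mD; apply: (measurability (@open 'rV[R]_n)) => //.
move=> _ [U oU <-].
pose r (k : nat) : R := k.+1%:R^-1.
pose box (qk : 'rV[rat]_n * nat) : set 'rV[R]_n :=
  [set v | forall i, ball (ratr (qk.1 0 i) : R) (r qk.2) (v 0 i)].
pose F qk : set T := if `[< box qk `<=` U >] then D `&` f @^-1` box qk else set0.
have -> : D `&` f @^-1` U = \bigcup_qk F qk.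
  apply/seteqP; split => [x [Dx Ufx]|x [qk _]]; last first.
    by rewrite /F; case: asboolP => // bU [Dx /bU].
  have [e /= e0 eU] : exists2 e : R, 0 < e & ball (f x) e `<=` U.
    by move: oU; rewrite openE => /(_ _ Ufx) /nbhs_ballP.
  have [k ke] : exists k : nat, r k < e / 2.
    have e20 : 0 < e / 2 by rewrite divr_gt0.
    have [k _ /(_ k (leqnn k))] := near_infty_natSinv_lt (PosNum e20).
    by exists k.
  have rk0 : 0 < r k by rewrite invr_gt0.
  have qP i : exists q : rat, ball (f x 0 i) (r k) (ratr q : R).
    have [|q qi] := @rat_in_itvoo R (f x 0 i - r k) (f x 0 i + r k).
      by rewrite ltrBlDr -addrA ltrDl addr_gt0.
    by exists q; rewrite ball_itv.
  pose q : 'rV[rat]_n := \row_i projT1 (cid (qP i)).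
  have qE i : ball (f x 0 i) (r k) (ratr (q 0 i) : R).
    by rewrite mxE; case: cid.
  exists (q, k) => //; rewrite /F; case: asboolP => [_|].
    by split => // i; apply: ball_sym; exact: qE.
  case=> v bv; apply: eU; split => // i j; rewrite ord1.
  apply: (@le_ball _ _ _ (r k + r k)); last exact: ball_triangle (qE j) (bv j).
  by rewrite (splitr e) ltW// ltrD.
apply: countable_bigcupT_measurable => // qk; rewrite /F; case: ifP => // _.
rewrite [X in measurable X](_ : _ =
    D `&` \big[setI/setT]_(i < n) (D `&` (fun x => f x 0 i) @^-1`
       ball (ratr (qk.1 0 i) : R) (r qk.2))).
  apply: measurableI => //; apply: bigsetI_measurable => i _.
  by apply: mf => //; exact: measurable_ball.
rewrite -bigcap_seq; apply/seteqP; split => [x [Dx bx]|x [Dx xI]]; split => //.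
  by move=> i _; split => //; exact: bx.
by move=> i; have [] := xI i (mem_index_enum _).
Qed.

Lemma measurable_coord_rV (i : 'I_n) :
  measurable_fun setT (fun v : 'rV[R]_n => v 0 i : R).
Proof.
move=> mT; apply: (measurability _ (RGenOpens.measurableE R)) => //.
move=> _ [_ [a [b ->] <-]]; rewrite setTI; apply: open_measurable_rV.
by have /continuousP := @coord_continuous R 1 n 0 i; apply; exact: interval_open.
Qed.

Lemma measurable_box_rV (A : 'I_n -> set R) : (forall i, measurable (A i)) ->
  measurable [set v : 'rV[R]_n | forall i, A i (v 0 i)].
Proof.
move=> mA; rewrite [X in measurable X](_ : _ =
    \big[setI/setT]_(i < n) (fun v : 'rV[R]_n => v 0 i) @^-1` A i).
  apply: bigsetI_measurable => i _; rewrite -[X in measurable X]setTI.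
  exact: measurable_coord_rV.
rewrite -bigcap_seq; apply/seteqP; split => [v Av i _|v Av i]; first exact: Av.
exact/Av/mem_index_enum.
Qed.

End borel_rV.

Section lebesgue_rV_step.
Variables (R : realType) (n : nat).

Definition rV_cons (p : measurableTypeR R * 'rV[R]_n) : 'rV[R]_(1 + n) :=
  row_mx (const_mx p.1) p.2.

Definition rV_uncons (v : 'rV[R]_(1 + n)) : measurableTypeR R * 'rV[R]_n :=
  (v 0 (lshift n 0), rsubmx v).

Lemma rV_consK : cancel rV_cons rV_uncons.
Proof.
by move=> [x v]; rewrite /rV_uncons /rV_cons row_mxKr row_mxEl mxE.
Qed.

Lemma measurable_rV_cons : measurable_fun setT rV_cons.
Proof.
apply: measurable_rV => i; case: (split_ordP i) => j ->.
  rewrite [X in measurable_fun _ X](_ : _ = fst)//.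
  by apply/funext => p; rewrite /rV_cons row_mxEl mxE.
rewrite [X in measurable_fun _ X](_ : _ = (fun v : 'rV[R]_n => v 0 j : R) \o snd).
  by apply: measurableT_comp => //; exact: measurable_coord_rV.
by apply/funext => p; rewrite /rV_cons row_mxEr.
Qed.

Lemma measurable_rV_uncons : measurable_fun setT rV_uncons.
Proof.
apply/measurable_fun_pairP; split; first exact: measurable_coord_rV.
apply: measurable_rV => j.
rewrite [X in measurable_fun _ X](_ : _ =
    fun v : 'rV[R]_(1 + n) => v 0 (rshift 1 j) : R).
  exact: measurable_coord_rV.
by apply/funext => v; rewrite /= mxE.
Qed.

Variable mu : {sigma_finite_measure set 'rV[R]_n -> \bar R}.

Definition lebesgue_rV_step : set 'rV[R]_n.+1 -> \bar R :=
  pushforward (lebesgue_measure \x mu)%E rV_cons.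

Let step0 : lebesgue_rV_step set0 = 0%E.
Proof. by rewrite /lebesgue_rV_step /pushforward preimage_set0 measure0. Qed.

Let step_ge0 A : (0 <= lebesgue_rV_step A)%E.
Proof. by rewrite /lebesgue_rV_step /pushforward measure_ge0. Qed.

Let step_sigma_additive : semi_sigma_additive lebesgue_rV_step.
Proof.
move=> F mF tF mUF; rewrite /lebesgue_rV_step /pushforward preimage_bigcup.
apply: measure_semi_sigma_additive.
- by move=> k; rewrite -[X in measurable X]setTI; exact: measurable_rV_cons.
- apply/trivIsetP => /= i j _ _ ij; rewrite -preimage_setI.
  by move/trivIsetP : tF => /(_ _ _ _ _ ij) ->//; rewrite preimage_set0.
- by rewrite -preimage_bigcup -[X in measurable X]setTI; exact: measurable_rV_cons.
Qed.

HB.instance Definition _ := isMeasure.Build _ _ _ lebesgue_rV_step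
  step0 step_ge0 step_sigma_additive.

Let step_sigma_finite : sigma_finite setT lebesgue_rV_step.
Proof.
have /sigma_finiteP[F [TF ndF Foo]] := sigma_finiteT (@lebesgue_measure R).
have /sigma_finiteP[G [TG ndG Goo]] := sigma_finiteT mu.
exists (fun k => rV_uncons @^-1` (F k `*` G k)) => [|k].
  rewrite -preimage_bigcup; apply/seteqP; split => // v _ /=.
  have [k _ Fk] : (\bigcup_k F k) (rV_uncons v).1 by rewrite -TF.
  have [l _ Gl] : (\bigcup_k G k) (rV_uncons v).2 by rewrite -TG.
  exists (maxn k l) => //; split.
  - by apply: (subsetPset _ _ (ndF _ _ (leq_maxl k l))).
  - by apply: (subsetPset _ _ (ndG _ _ (leq_maxr k l))).
have [mF Fk] := Foo k; have [mG Gk] := Goo k; split.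
  rewrite -[X in measurable X]setTI.
  by apply: measurable_rV_uncons => //; exact: measurableX.
rewrite /lebesgue_rV_step /pushforward -comp_preimage.
rewrite (_ : rV_uncons \o rV_cons = id); last exact/funext/rV_consK.
by rewrite preimage_id product_measure1E// lte_mul_pinfty// ge0_fin_numE.
Qed.

HB.instance Definition _ := Measure_isSigmaFinite.Build _ _ _ lebesgue_rV_step
  step_sigma_finite.

End lebesgue_rV_step.

Section lebesgue_rV.
Variable R : realType.

(* The n-fold product of the one-dimensional Lebesgue measure, carried to
   'rV[R]_n; lebesgue_rV_box characterizes it. *)
Fixpoint lebesgue_rV (n : nat) : {sigma_finite_measure set 'rV[R]_n -> \bar R} :=
  match n with
  | 0 => \d_(0 : 'rV[R]_0)
  | m.+1 => lebesgue_rV_step (lebesgue_rV m)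
  end.

Lemma lebesgue_rV_box (n : nat) (A : 'I_n -> set R) :
  (forall i, measurable (A i)) ->
  lebesgue_rV n [set v | forall i, A i (v 0 i)] =
  (\prod_(i < n) lebesgue_measure (A i))%E.
Proof.
elim: n A => [A _|n IHn A mA].
  by rewrite big_ord0 /= diracE mem_set//; case.
rewrite big_ord_recl -IHn//= -product_measure1E//; first last.
- by apply: (measurable_box_rV (A := fun i => A (lift ord0 i))) => i; exact: mA.
- exact: mA.
rewrite /lebesgue_rV_step /pushforward; congr (_ _).
have cons0 x (v : 'rV[R]_n) : (rV_cons (x, v) : 'rV_n.+1) 0 ord0 = x.
  transitivity (row_mx (const_mx x) v 0 (lshift n (0 : 'I_1))).
    by congr (fun_of_matrix _ _ _); exact/val_inj.
  by rewrite row_mxEl mxE.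
have consS x (v : 'rV[R]_n) i : (rV_cons (x, v) : 'rV_n.+1) 0 (lift ord0 i) = v 0 i.
  transitivity (row_mx (const_mx x : 'rV_1) v 0 (rshift 1 i)).
    by congr (fun_of_matrix _ _ _); exact/val_inj.
  by rewrite row_mxEr.
apply/seteqP; split => [[x v] /= Av|[x v] /= [Ax Av] i].
  by split => [|i]; [rewrite -(cons0 x v)|rewrite -(consS x v)]; exact: Av.
by have [j ->|->] := unliftP ord0 i; [rewrite consS|rewrite cons0].
Qed.

End lebesgue_rV.

Definition cexp (R : realType) (z : R[i]) : R[i] :=
  (expR (complex.Re z))%:C * (cos (complex.Im z) +i* sin (complex.Im z)).

(* Bilinear, without conjugation. *)
Definition dotp (K : pzSemiRingType) (d : nat) (a b : 'rV[K]_d) : K :=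
  \sum_(m < d) a 0 m * b 0 m.

(* Elements of L^2(D) are represented by functions defined on the whole space,
   of which only the restriction to D matters, and equality in L^2(D) is
   equality a.e. on D. An operator from L^2(U) to L^2(D) is represented by its
   action on representatives. *)
Section truncated_convolution.
Variables (R : realType) (d : nat).
Local Notation Rd := 'rV[R]_d.
Local Notation C := R[i].
Local Notation mu := (lebesgue_rV R d).
Implicit Types (D U : set Rd) (f g : Rd -> C).

Definition cintegral D f : C :=
  (\int[mu]_(x in D) complex.Re (f x)) +i* (\int[mu]_(x in D) complex.Im (f x)).

Definition L2 D f : Prop :=
  [/\ measurable_fun D (fun x => complex.Re (f x)),
      measurable_fun D (fun x => complex.Im (f x)) &
      (\int[mu]_(x in D) (ComplexField.Normc.normc (f x) ^+ 2)%:E < +oo)%E].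

Definition L2_inner D f g : C := cintegral D (fun x => f x * (g x)^*).

Definition trunc_conv f U g : Rd -> C :=
  fun x => cintegral U (fun y => f (x - y) * g y).

(* The order of R[i] makes 0 <= z say that z is real and nonnegative. *)
Definition psd D (A : (Rd -> C) -> (Rd -> C)) : Prop :=
  forall g, L2 D g -> 0 <= L2_inner D (A g) g.

(* The classes modulo a.e. equality on D of the functions in V have a basis
   (the classes of the e k) with K elements. *)
Definition has_dim D (V : set (Rd -> C)) (K : nat) : Prop :=
  exists e : 'I_K -> Rd -> C,
  [/\ forall k, V (e k),
      forall a : 'I_K -> C,
        (fun x => \sum_k a k * e k x) = (fun=> 0) %[ae mu in D] ->
        forall k, a k = 0 &
      forall h, V h -> exists a : 'I_K -> C,
        h = (fun x => \sum_k a k * e k x) %[ae mu in D]].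

Definition has_rank U D (A : (Rd -> C) -> (Rd -> C)) (K : nat) : Prop :=
  has_dim D [set A g | g in L2 U] K.

End truncated_convolution.

(* Main.v *)
Require Import Defs.
From mathcomp Require Import all_boot all_order all_algebra.
From mathcomp Require Import all_classical all_reals all_analysis.
From mathcomp Require Import complex.
From mathcomp Require Import measurable_realfun spectral ring lra.

(** One direction is a computation. If [f] is a sum of waves [c_k e^(i xi_k.x)]
    on the difference set, the operator is [sum_k c_k <g, e_k> e_k] with
    [e_k = e^(i xi_k.x)], which is positive semidefinite; the waves are linearly
    independent on an open set ([plane_wave_indep]), so their Gram matrix is
    invertible and the rank is the number of waves ([plane_waves_psd],
    [plane_waves_rank]).

    For the converse, let [A] be the operator, positive semidefinite of finite
    rank. Consider the form [<A g, h>] on Lipschitz test functions vanishing off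
    [Xi]. An orthonormal family for this form has at most [K] elements, so a
    maximal one [g_1, ..., g_m] exists, and with [e_l = A g_l] positivity gives
    [A g = sum_l <g, e_l> e_l] for every test [g] ([psd_form_basis]). Since
    [A g] is the integral of [f z * g (x - z)] over a fixed domain, the [e_l]
    are continuous. Test functions separate integrable functions, so for each
    [x] in [Xi]

      [f (x - y) = k x y := sum_l e_l x * conj (e_l y)]  for almost every [y]

    ([finite_rank_kernel]). The left-hand side depends on [x - y] only, hence by
    continuity [k (x + h) (y + h) = k x y] whenever the four points lie in [Xi].

    Let [v x] be the row vector of the [e_l x], so that [k x y] is the Hermitian
    product of [v x] and [v y]. Translations preserve these products, therefore
    they preserve linear relations between the vectors [v x], and small
    translations act on them by unitary matrices: [v (x + h) = v x * U h] with
    [U (h + h') = U h * U h']. These commute and are closed under adjoints, so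
    one unitary matrix diagonalizes all of them ([commuting_adjoint_diag]); the
    diagonal entries are continuous unitary characters defined near 0, that is
    [e^(i xi_k.h)] ([local_character]). In the new coordinates the quotient of
    the [k]-th component of [v x] by [e^(i xi_k.x)] is locally constant, hence
    equal to a constant [w_k] on the connected set [Xi], and
    [k x y = sum_k |w_k|^2 e^(i xi_k.(x - y))]
    ([translation_invariant_kernel]). Grouping equal frequencies and dropping
    zero coefficients gives [f] the required form with some number [p] of waves,
    and the first part forces [p = K]. *)

Set Implicit Arguments.
Unset Strict Implicit.
Unset Printing Implicit Defensive.

Import Order.TTheory GRing.Theory Num.Theory.
Import numFieldTopology.Exports numFieldNormedType.Exports.

Local Open Scope classical_set_scope.

Local Open Scope complex_scope.
(* On top of the other scopes, so that [^*] denotes [Num.conj]. *)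
Local Open Scope ring_scope.

(** * Lebesgue measure on row vectors *)

Section rV_measure.
Variables (R : realType) (n : nat).
Local Notation Rn := 'rV[R]_n.
Local Notation mu := (lebesgue_rV R n).

Lemma coord_rV_le_norm (v : Rn) i : `|v 0 i| <= `|v|.
Proof.
by rewrite [leRHS]/Num.Def.normr /= mx_normrE; apply/bigmax_geP; right => /=; exists (0, i).
Qed.

Lemma norm_rV_ltP (v : Rn) (e : R) : 0 < e ->
  `|v| < e <-> forall i, `|v 0 i| < e.
Proof.
move=> e0; split => [ve i|ve]; first exact: le_lt_trans (coord_rV_le_norm v i) ve.
rewrite [ltLHS]/Num.Def.normr /= mx_normrE; apply/bigmax_ltP; split => // -[i j] _ /=.
by rewrite ord1.
Qed.

Lemma lebesgue_measure_reflect (a : R) (A : set R) : measurable A ->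
  lebesgue_measure ((fun t => a - t) @^-1` A) = lebesgue_measure A.
Proof.
move=> mA.
have mr : measurable_fun setT (fun t : measurableTypeR R => (a - t : measurableTypeR R)).
  by apply: measurable_funB => //; exact: measurable_id.
pose nuM : {measure set (measurableTypeR R) -> \bar R} :=
  measure_function_pushforward__canonical__measure_function_Measure
     (@lebesgue_measure R) mr.
suff -> : lebesgue_measure A = nuM A by [].
apply: lebesgue_measure_unique => //= _ [[b c]] _ <-.
rewrite /pushforward (_ : _ @^-1` _ = `[a - c, a - b[%classic); last first.
  by apply/seteqP; split => t /=; rewrite !in_itv/= => /andP[? ?]; apply/andP; split; lra.
rewrite !lebesgue_measure_itv/= !lte_fin ltrD2l ltrN2; case: ifP => // _.
by rewrite -!EFinB; congr EFin; ring.
Qed.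

Lemma measurable_reflect_rV (a : Rn) : measurable_fun setT (fun v : Rn => a - v).
Proof.
apply: measurable_rV => i.
under eq_fun do rewrite !mxE.
by apply: measurable_funB => //; exact: measurable_coord_rV.
Qed.

Definition measurable_boxes : set (set Rn) :=
  [set B | exists2 A : 'I_n -> set R, (forall i, measurable (A i)) &
           B = [set v : Rn | forall i, A i (v 0 i)]].

(** A coordinate is measurable for the sigma-algebra generated by the boxes,
    so [measurable_rV], applied to the identity from that sigma-algebra to the
    Borel one, gives the nontrivial inclusion. *)
Lemma measurable_rVE : (@measurable _ Rn) = <<s measurable_boxes >>.
Proof.
apply/seteqP; split; last first.
  apply: smallest_sub; first exact: sigma_algebra_measurable.
  by move=> _ [A mA ->]; exact: measurable_box_rV.
have mid : measurable_fun setT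
    (fun v : g_sigma_algebraType measurable_boxes => (v : Rn)).
  apply: measurable_rV => i mT B mB; rewrite setTI; apply: sub_sigma_algebra.
  exists (fun j => if j == i then B else setT) => [j|]; first by case: ifP.
  apply/seteqP; split => [v /= Bv j|v /= /(_ i)]; last by rewrite eqxx.
  by case: eqP => // ->.
by move=> A mA; have := mid measurableT A mA; rewrite setTI.
Qed.

Lemma setI_closed_boxes : setI_closed measurable_boxes.
Proof.
move=> _ _ [A mA ->] [B mB ->]; exists (fun i => A i `&` B i).
  by move=> i; exact: measurableI.
apply/seteqP; split => v /= => [[Av Bv] i|ABv]; first by split.
by split => i; have [] := ABv i.
Qed.

(** The boxes are a generating pi-system on which the product formula reduces
    the claim to dimension one. Reflections alone are enough: a translation is a
    product of two of them. *)
Lemma lebesgue_rV_reflect (a : Rn) (A : set Rn) : measurable A ->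
  mu ((fun v => a - v) @^-1` A) = mu A.
Proof.
move=> mA.
pose nuM : {measure set Rn -> \bar R} :=
  measure_function_pushforward__canonical__measure_function_Measure
     mu (measurable_reflect_rV a).
suff : nuM A = mu A by [].
apply/esym; move: A mA.
apply: (@measure_unique _ _ _ measurable_boxes
   (fun k => [set v : Rn | forall i, `]-k%:R, k%:R[%classic (v 0 i)])) => //.
- exact: measurable_rVE.
- exact: setI_closed_boxes.
- by move=> k; exists (fun=> `]-k%:R, k%:R[%classic).
- apply/seteqP; split => // v _.
  exists (Num.truncn `|v|).+1 => // i /=; rewrite in_itv /= -ltr_norml.
  by rewrite (le_lt_trans (coord_rV_le_norm v i))// truncnS_gt.
- move=> _ [B mB ->].
  rewrite [RHS](_ : _ = mu [set v | forall i, ((fun t => a 0 i - t) @^-1` B i) (v 0 i)]); last first.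
    congr (mu _).
    by apply/seteqP; split => v /= h i; have := h i; rewrite !mxE.
  transitivity (\prod_(i < n) lebesgue_measure (B i))%E.
    exact: lebesgue_rV_box.
  transitivity (\prod_(i < n)
      lebesgue_measure ((fun t : R => a 0 i - t)%R @^-1` B i))%E.
    by apply: eq_bigr => i _; rewrite lebesgue_measure_reflect.
  symmetry; apply: lebesgue_rV_box => i.
  rewrite -[X in measurable X]setTI.
  have : measurable_fun setT (fun t : measurableTypeR R => (a 0 i - t : measurableTypeR R)).
    by apply: measurable_funB => //; exact: measurable_id.
  by move=> h; exact: (h measurableT (B i) (mB i)).
- move=> k.
  rewrite [ltLHS](_ : _ = (\prod_(i < n) lebesgue_measure `](- k%:R)%R, k%:R[%classic)%E);
    last exact: (lebesgue_rV_box (A := fun=> `]-k%:R, k%:R[%classic)).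
  rewrite (eq_bigr (fun=> (k%:R + k%:R)%:E)) => [|i _].
    by rewrite prodEFin ltry.
  rewrite lebesgue_measure_itv/= lte_fin opprK; case: ifPn => //.
  rewrite -leNgt => k0; congr EFin.
  have /eqP -> : k%:R == 0 :> R by rewrite eq_le ler0n andbT; lra.
  by rewrite addr0.
Qed.

Lemma open_rV_box_gt0 (x : Rn) (e : R) : 0 < e -> (0 < mu (ball x e))%E.
Proof.
move=> e0.
rewrite (_ : ball x e = [set v | forall i, ball (x 0 i) e (v 0 i)]); last first.
  apply/seteqP; split => v /= => [[]|] h; first by move=> h' i; apply: h'.
  by split => // i j; rewrite ord1; exact: h.
rewrite (lebesgue_rV_box (A := fun i => ball (x 0 i) e)) => [|i]; last exact: measurable_ball.
rewrite (eq_bigr (fun=> (e *+ 2)%:E)) => [|i _].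
  by rewrite prodEFin lte_fin; apply: prodr_gt0 => i _; rewrite mulr2n addr_gt0.
by rewrite lebesgue_measure_ball// ltW.
Qed.

Lemma bounded_rV_lty (A : set Rn) : measurable A -> bounded_set A ->
  (mu A < +oo)%E.
Proof.
move=> mA [M [_ bA]].
have {}bA := bA (M + 1) ltac:(lra).
pose B : set Rn := [set v | forall i, `[- (M + 1), M + 1]%classic (v 0 i)].
have mB : measurable B by exact: (measurable_box_rV (A := fun=> `[- (M + 1), M + 1]%classic)).
apply: (@le_lt_trans _ _ (mu B)).
  apply: le_measure; rewrite ?inE// => v /bA /= vM i /=.
  rewrite in_itv /= -ler_norml; exact: le_trans (coord_rV_le_norm v i) vM.
rewrite (lebesgue_rV_box (A := fun=> `[- (M + 1), M + 1]%classic))//.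
pose c : \bar R := lebesgue_measure `[- (M + 1), M + 1]%classic.
have : c \is a fin_num by rewrite /c lebesgue_measure_itv/=; case: ifP.
rewrite -/c => /fineK <-.
by rewrite prodEFin ltry.
Qed.

End rV_measure.

(** * Change of variables, and null sets against open sets *)

Section rV_integral.
Variables (R : realType) (n : nat).
Local Notation Rn := 'rV[R]_n.
Local Notation mu := (lebesgue_rV R n).

Lemma measurable_preimage_reflect (a : Rn) (D : set Rn) :
  measurable D -> measurable ((fun v => a - v) @^-1` D).
Proof.
by move=> mD; rewrite -[X in measurable X]setTI; exact: measurable_reflect_rV.
Qed.

Lemma measurable_fun_reflect (a : Rn) (D : set Rn) d (T : measurableType d)
  (h : Rn -> T) : measurable D ->
  measurable_fun D h -> measurable_fun ((fun v => a - v) @^-1` D) (fun v => h (a - v)).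
Proof.
move=> mD mh; apply: (measurable_comp mD) => //; first by move=> _ [v Dv <-].
exact: measurable_funTS (measurable_reflect_rV a).
Qed.

Lemma ge0_integral_reflect (a : Rn) (D : set Rn) (h : Rn -> \bar R) :
  measurable D -> measurable_fun D h -> {in D, forall x, 0 <= h x}%E ->
  (\int[mu]_(x in (fun v => (a - v)%R) @^-1` D) h (a - x)%R = \int[mu]_(x in D) h x)%E.
Proof.
move=> mD mh h0.
rewrite -(ge0_integral_pushforward (measurable_reflect_rV a) _ mD mh h0).
apply: eq_measure_integral => [|mr A mA _]; first exact: measurable_reflect_rV.
exact: lebesgue_rV_reflect.
Qed.

Lemma integral_reflect (a : Rn) (D : set Rn) (h : Rn -> \bar R) :
  measurable D -> measurable_fun D h ->
  (\int[mu]_(x in (fun v => (a - v)%R) @^-1` D) h (a - x)%R = \int[mu]_(x in D) h x)%E.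
Proof.
move=> mD mh; rewrite integralE [RHS]integralE; congr (_ - _)%E.
  rewrite -(ge0_integral_reflect a mD (measurable_funepos mh)) => [|x _]; last exact: funepos_ge0.
  by apply: eq_integral => x _; rewrite !funeposE.
rewrite -(ge0_integral_reflect a mD (measurable_funeneg mh)) => [|x _]; last exact: funeneg_ge0.
by apply: eq_integral => x _; rewrite !funenegE.
Qed.

Lemma integrable_reflect (a : Rn) (D : set Rn) (h : Rn -> \bar R) :
  measurable D -> mu.-integrable D h ->
  mu.-integrable ((fun v => a - v) @^-1` D) (fun v => h (a - v)).
Proof.
move=> mD /integrableP[mh hoo]; apply/integrableP; split.
  exact: measurable_fun_reflect.
rewrite (ge0_integral_reflect a (h := fun x => `|h x|%E))//.
exact: measurableT_comp.
Qed.

Lemma ae_reflect (a : Rn) (P : Rn -> Prop) :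
  (\forall x \ae mu, P x) -> \forall x \ae mu, P (a - x).
Proof.
move=> [N [mN N0 PN]]; exists ((fun v => a - v) @^-1` N); split.
- exact: measurable_preimage_reflect.
- by rewrite lebesgue_rV_reflect.
- by move=> x /= nP; apply: PN.
Qed.

Lemma ae_shift (a : Rn) (P : Rn -> Prop) :
  (\forall x \ae mu, P x) -> \forall x \ae mu, P (x + a).
Proof.
move=> /(ae_reflect a) /(ae_reflect 0).
by apply: filterS => x; rewrite sub0r opprK addrC.
Qed.

(** Open sets have positive measure, so they cannot be null: this is how almost
    everywhere statements about continuous functions become pointwise. *)
Lemma ae_open_ex (U : set Rn) (P : Rn -> Prop) :
  open U -> U !=set0 -> (\forall x \ae mu, U x -> P x) ->
  exists2 x, U x & P x.
Proof.
move=> oU [x Ux] [N [mN N0 PN]]; apply: contrapT => nP.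
have UN : U `<=` N by move=> y Uy; apply: PN => /= /(_ Uy) Py; apply: nP; exists y.
have [e /= e0 eU] : exists2 e : R, 0 < e & ball x e `<=` U.
  by move: oU; rewrite openE => /(_ _ Ux) /nbhs_ballP.
have := open_rV_box_gt0 x e0; rewrite ltNge => /negP; apply.
rewrite -N0; apply: le_measure; rewrite ?inE//.
  by apply: open_measurable_rV; exact: ball_open.
exact: subset_trans UN.
Qed.

Lemma open_continuous_neq0 (U : set Rn) (h : Rn -> R) : open U ->
  (forall x, U x -> {for x, continuous h}) -> open (U `&` [set x | h x != 0]).
Proof.
move=> oU ch; rewrite openE => x [Ux hx]; apply: filterI.
  by apply: open_nbhs_nbhs; split.
apply: (ch _ Ux [set y | y != 0]).
by apply: open_nbhs_nbhs; split => //; exact: open_neq.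
Qed.

Lemma ae_eq0_continuous (U : set Rn) (h : Rn -> R) : open U ->
  (forall x, U x -> {for x, continuous h}) ->
  (\forall x \ae mu, U x -> h x = 0) -> forall x, U x -> h x = 0.
Proof.
move=> oU ch h0 x Ux; apply: contrapT => /eqP hx.
have [|y [Uy +] ] := ae_open_ex (open_continuous_neq0 oU ch) _
  (filterS (P := fun x => U x -> h x = 0)
     (fun y hy => fun Uhy : (U `&` [set x | h x != 0]) y => hy (proj1 Uhy)) h0).
  by exists x.
by move=> /= /eqP.
Qed.

Lemma measurable_continuous_rV (D : set Rn) (h : Rn -> R) : open D ->
  (forall x, D x -> {for x, continuous h}) -> measurable_fun D h.
Proof.
move=> oD ch mD; apply: (measurability _ (RGenOpens.measurableE R)) => //.
move=> _ [_ [a [b ->] <-]]; apply: open_measurable_rV.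
suff : open (D `&` h @^-1` `]a, b[%classic) by [].
rewrite openE => x [Dx hx]; apply: filterI; first by apply: open_nbhs_nbhs; split.
by apply: (ch _ Dx); apply: open_nbhs_nbhs; split => //; exact: interval_open.
Qed.

End rV_integral.

(** * Lipschitz test functions *)

Section test_functions.
Variables (R : realType) (n : nat).
Local Notation Rn := 'rV[R]_n.
Local Notation mu := (lebesgue_rV R n).

(** The Lipschitz bound makes convolutions of test functions with integrable
    functions Lipschitz, hence continuous, by a direct estimate. *)
Definition test_fun (D : set Rn) (g : Rn -> R) : Prop :=
  [/\ exists L, forall x y, `|g x - g y| <= L * `|x - y|,
      exists M, forall x, `|g x| <= M &
      forall x, ~ D x -> g x = 0].

(** The distance to the complement, truncated at 1 so that it exists even when
    the complement is empty. *)
Definition depth (U : set Rn) (y : Rn) : R :=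
  sup [set t | 0 <= t <= 1 /\ ball y t `<=` U].

Lemma ball_rV0 (y : Rn) : ball y (0 : R) = set0.
Proof.
by rewrite -ball_normE; apply/seteqP; split => // z /=; rewrite ltNge normr_ge0.
Qed.

Lemma depth_set (U : set Rn) y :
  has_sup [set t : R | 0 <= t <= 1 /\ ball y t `<=` U].
Proof.
split; last by exists 1 => t [/andP[]].
exists 0; split; first by rewrite lexx ler01.
by rewrite ball_rV0.
Qed.

Lemma depth_ge U y t : 0 <= t <= 1 -> ball y t `<=` U -> t <= depth U y.
Proof. by move=> t01 ytU; apply: ub_le_sup => //; exact: (depth_set U y).2. Qed.

Lemma depth_ge0 U y : 0 <= depth U y.
Proof. by apply: depth_ge; rewrite ?lexx ?ler01// ball_rV0. Qed.

Lemma depth_out U y : ~ U y -> depth U y = 0.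
Proof.
move=> nUy; apply/eqP; rewrite eq_le depth_ge0 andbT.
apply: ge_sup => [|t [/andP[t0 _] ytU]]; first exact: (depth_set U y).1.
by rewrite leNgt; apply/negP => t_gt0; apply/nUy/ytU; exact: ballxx.
Qed.

Lemma depth_gt0 U y : open U -> U y -> 0 < depth U y.
Proof.
move=> oU Uy.
have [e /= e0 eU] : exists2 e : R, 0 < e & ball y e `<=` U.
  by move: oU; rewrite openE => /(_ _ Uy) /nbhs_ballP.
apply: (@lt_le_trans _ _ (Num.min e 1)); first by rewrite lt_min e0 ltr01.
apply: depth_ge; first by rewrite le_min ltW//= ler01 ge_min lexx orbT.
by apply: subset_trans eU; apply: le_ball; rewrite ge_min lexx.
Qed.

Lemma depth_lipschitz U x y : `|depth U x - depth U y| <= `|x - y|.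
Proof.
wlog suff key : x y / depth U x - `|x - y| <= depth U y.
  rewrite ler_norml; have := key x y; have := key y x.
  rewrite (distrC y x); move: (depth U x) (depth U y) `|x - y| => a b c ? ?.
  by apply/andP; split; lra.
rewrite lerBlDr; apply: ge_sup => [|t [/andP[t0 t1] xtU]].
  exact: (depth_set U x).1.
(* A ball around [x] of radius t contains the one around [y] of radius
   t - |x - y|, unless that radius is negative. *)
have [txy|xyt] := leP t `|x - y|; first by have := depth_ge0 U y; lra.
rewrite -lerBlDr; apply: depth_ge; first by have := normr_ge0 (x - y); lra.
apply: subset_trans xtU => z yz.
have -> : t = `|x - y| + (t - `|x - y|) by lra.
move: yz; rewrite -!ball_normE /= => yz.
rewrite (_ : x - z = (x - y) + (y - z)); last by rewrite addrA subrK.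
by rewrite (le_lt_trans (ler_normD _ _))// ltrD2l.
Qed.

Lemma min1_lipschitz (a b : R) : `|Num.min 1 a - Num.min 1 b| <= `|a - b|.
Proof.
wlog ab : a b / a <= b => [hw|].
  by case/orP: (le_total a b) => /hw //; rewrite distrC (distrC a).
rewrite (distrC a) (ger0_norm (x := b - a)) ?subr_ge0// ler_norml.
by case: (leP 1 a) => ?; case: (leP 1 b) => ?; apply/andP; split; lra.
Qed.

(** These increase with [k] to the indicator of the open set [U]. *)
Definition bump (U : set Rn) (k : nat) (y : Rn) : R :=
  Num.min 1 (k%:R * depth U y).

Lemma bump_ge0 U k y : 0 <= bump U k y.
Proof. by rewrite /bump le_min ler01 mulr_ge0// depth_ge0. Qed.

Lemma bump_le1 U k y : bump U k y <= 1.
Proof. by rewrite /bump ge_min lexx. Qed.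

Lemma bump_norm_le1 U k y : `|bump U k y| <= 1.
Proof. by rewrite ger0_norm ?bump_ge0// bump_le1. Qed.

Lemma bump_out U k y : ~ U y -> bump U k y = 0.
Proof. by move=> /depth_out Uy; rewrite /bump Uy mulr0 min_r// ler01. Qed.

Lemma bump_test (D U : set Rn) k : U `<=` D -> test_fun D (bump U k).
Proof.
move=> UD; split; last by move=> x nDx; apply: bump_out => /UD.
  exists k%:R => x y.
  have Hk : `|k%:R * depth U x - k%:R * depth U y| <= k%:R * `|x - y|.
    by rewrite -mulrBr normrM ger0_norm// ler_wpM2l// depth_lipschitz.
  apply: le_trans Hk; rewrite /bump.
  exact: min1_lipschitz.
by exists 1 => x; exact: bump_norm_le1.
Qed.

Lemma bump_cvg U y : open U -> U y -> bump U ^~ y @ \oo --> (1 : R).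
Proof.
move=> oU Uy; apply: cvg_near_cst.
have d0 := depth_gt0 oU Uy.
near=> k; rewrite /bump min_l// -ler_pdivrMr// mul1r.
near: k; exact: nbhs_infty_ger.
Unshelve. all: by end_near. Qed.

Lemma lipschitz_continuous (g : Rn -> R) :
  (exists L, forall x y, `|g x - g y| <= L * `|x - y|) -> continuous g.
Proof.
move=> [L gL] x; apply/(@cvgrPdist_lt _ _ _ _ (nbhs_filter x)) => e e0.
have L0 : 0 < `|L| + 1 by rewrite ltr_wpDl.
have : nbhs x (ball x (e / (`|L| + 1))) by apply: nbhsx_ballx; exact: divr_gt0.
apply: filterS => y; rewrite -ball_normE /= ltr_pdivlMr// mulrC => xy.
apply: le_lt_trans xy; apply: (le_trans (gL x y)).
by rewrite ler_wpM2r// (le_trans (ler_norm _))// lerDl.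
Qed.

Lemma test_fun_measurable D (E : set Rn) g : test_fun D g -> measurable_fun E g.
Proof.
move=> [Lg _ _]; apply: (@measurable_funS _ _ _ _ setT) => //.
apply: measurable_continuous_rV => [|x _]; first exact: openT.
exact: lipschitz_continuous.
Qed.

(** By dominated convergence along the bumps, [h] has integral 0 on every open
    subset of [D]; open sets form a pi-system generating the Borel sets, and the
    sets on which the integral of [h] vanishes form a Dynkin system. *)
Lemma test_fun_separate (D : set Rn) (h : Rn -> R) :
  open D -> mu.-integrable D (EFin \o h) ->
  (forall g, test_fun D g -> \int[mu]_(x in D) (h x * g x) = 0) ->
  h = cst 0 %[ae mu in D].
Proof.
move=> oD ih h0.
have mD : measurable D by exact: open_measurable_rV.
have mh : measurable_fun D h by apply/measurable_EFinP; exact: measurable_int ih.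
have hU U : open U -> (\int[mu]_(x in D `&` U) (h x)%:E = 0)%E.
  move=> oU; have oDU : open (D `&` U) by exact: openI.
  pose f_ k x := (h x * bump (D `&` U) k x)%:E.
  pose f x := ((h x)%:E * (\1_(D `&` U) x)%:E)%E.
  have mf_ k : measurable_fun D (f_ k).
    apply/measurable_EFinP; apply: measurable_funM => //.
    by apply: test_fun_measurable; exact: (@bump_test D).
  have [||||_ _] := @dominated_convergence _ _ _ mu D mD f_ f (fun x => `|(h x)%:E|%E) mf_.
  - apply: emeasurable_funM; first exact/measurable_EFinP.
    apply/measurable_EFinP; apply: measurable_funTS.
    by apply: measurable_indic; exact: open_measurable_rV.
  - apply: aeW => x Dx; rewrite /f /f_ -EFinM.
    apply: cvg_EFin; first exact: nearW.
    apply: (cvgM (cvg_cst _)).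
    rewrite indicE; have [xU|xU] := pselect ((D `&` U) x).
    + by rewrite mem_set//; exact: bump_cvg.
    + rewrite memNset//; apply: cvg_near_cst; apply: nearW => k; exact: bump_out.
  - exact: integrable_abse.
  - apply: aeW => x k Dx; rewrite /f_ /= lee_fin normrM ler_piMr//.
    exact: bump_norm_le1.
  have int0 k : (\int[mu]_(x in D) f_ k x = 0)%E.
    have itf : mu.-integrable D (EFin \o (fun x => h x * bump (D `&` U) k x)).
      apply: (le_integrable mD _ _ ih) => [|x Dx]; first exact: mf_.
      by rewrite /= lee_fin normrM ler_piMr// bump_norm_le1.
    rewrite -[LHS]fineK; last exact: integrable_fin_num itf.
    by have := h0 _ (@bump_test D (D `&` U) k (@subIsetl _ _ _)); rewrite /Rintegral => ->.
  rewrite [X in X @ _ --> _](_ : _ = cst 0%E); last exact/funext.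
  move=> /(cvg_lim (@ereal_hausdorff R)); rewrite lim_cst; last exact: ereal_hausdorff.
  rewrite integral_mkcondr => ->.
  apply: eq_integral => x xD; rewrite /f indicE in_setI xD /=.
  by rewrite patchE -EFinM; case: (x \in _) => /=; rewrite ?mulr1 ?mulr0.
have hB B : measurable B -> (\int[mu]_(x in D `&` B) (h x)%:E = 0)%E.
  pose H := [set B : set Rn | measurable B /\ (\int[mu]_(x in D `&` B) (h x)%:E = 0)%E].
  suff HB : <<s @open Rn >> `<=` H by move=> /HB[].
  rewrite -setI_closed_g_dynkin_g_sigma_algebra; last exact: openI.
  apply: smallest_sub; last first.
    by move=> U oU; split; [exact: open_measurable_rV|exact: hU].
  split; first by split => //; apply: hU; exact: openT.
  - move=> A [mA A0]; split; first exact: measurableC.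
    have := hU _ openT; rewrite setIT -{1}(setUIDK D A) integral_setU => //; last 4 first.
    + exact: measurableI.
    + exact: measurableD.
    + by rewrite setUIDK; exact/measurable_EFinP.
    + by apply/disj_setPS => x [[_ +] [_]].
    by rewrite A0 add0e setDE.
  - move=> F tF HF; split; first by apply: bigcup_measurable => k _; have [] := HF k.
    rewrite setI_bigcupr integral_bigcup.
    + by apply: eseries0 => k _ _; have [] := HF k.
    + by apply: trivIset_setIl.
    + by move=> k; apply: measurableI => //; have [] := HF k.
    + apply: integrableS ih => //.
        by apply: bigcup_measurable => k _; apply: measurableI => //; have [] := HF k.
      by move=> x [k _ []].
have h_ae : ae_eq mu D (EFin \o h) (cst 0%E).
  apply: integral_ae_eq => // E ED mE.
  by rewrite [RHS]integral0 -[RHS](hB E mE) setIidr.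
by apply: filterS h_ae => x hx Dx; have [] := hx Dx.
Qed.

End test_functions.

(** * Complex integrals *)

Section complex_integral.
Variables (R : realType) (n : nat).
Local Notation Rn := 'rV[R]_n.
Local Notation C := R[i].
Local Notation mu := (lebesgue_rV R n).
Local Notation Re := (@complex.Re R).
Local Notation Im := (@complex.Im R).
Implicit Types (D : set Rn) (f g h : Rn -> C).

Lemma ReD (x y : C) : Re (x + y) = Re x + Re y. Proof. by case: x y => ? ? []. Qed.
Lemma ImD (x y : C) : Im (x + y) = Im x + Im y. Proof. by case: x y => ? ? []. Qed.
Lemma ReM (x y : C) : Re (x * y) = Re x * Re y - Im x * Im y.
Proof. by case: x y => ? ? []. Qed.
Lemma ImM (x y : C) : Im (x * y) = Re x * Im y + Im x * Re y.
Proof. by case: x y => ? ? []. Qed.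
Lemma Re_conj (x : C) : Re x^* = Re x. Proof. by case: x. Qed.
Lemma Im_conj (x : C) : Im x^* = - Im x. Proof. by case: x. Qed.
Lemma complex_ext (x y : C) : Re x = Re y -> Im x = Im y -> x = y.
Proof. by case: x y => ? ? [? ?] /= -> ->. Qed.

Lemma normc_sqr (z : C) : ComplexField.Normc.normc z ^+ 2 = Re z ^+ 2 + Im z ^+ 2.
Proof. by case: z => a b /=; rewrite sqr_sqrtr// addr_ge0 ?sqr_ge0. Qed.

Definition cmeasurable D f :=
  measurable_fun D (fun x => Re (f x)) /\ measurable_fun D (fun x => Im (f x)).

Definition cintegrable D f :=
  mu.-integrable D (EFin \o (fun x => Re (f x))) /\
  mu.-integrable D (EFin \o (fun x => Im (f x))).

Lemma cintegrable_cmeasurable D f : cintegrable D f -> cmeasurable D f.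
Proof.
by move=> [rf jf]; split; apply/measurable_EFinP; [exact: measurable_int rf|
  exact: measurable_int jf].
Qed.

Lemma cmeasurableM D f g : cmeasurable D f -> cmeasurable D g ->
  cmeasurable D (fun x => f x * g x).
Proof.
move=> [rf jf] [rg jg]; split.
  by under eq_fun do rewrite ReM; apply: measurable_funB; exact: measurable_funM.
by under eq_fun do rewrite ImM; apply: measurable_funD; exact: measurable_funM.
Qed.

Lemma cmeasurable_conj D f : cmeasurable D f -> cmeasurable D (fun x => (f x)^*).
Proof.
move=> [rf jf]; split; first by under eq_fun do rewrite Re_conj.
by under eq_fun do rewrite Im_conj; apply: measurableT_comp.
Qed.

Lemma eq_cintegral D f g : (forall x, D x -> f x = g x) ->
  cintegral D f = cintegral D g.
Proof.
by move=> fg; congr Complex; apply: eq_Rintegral => x /set_mem /fg ->.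
Qed.

Lemma ae_eq_cintegral D f g : measurable D -> cmeasurable D f -> cmeasurable D g ->
  f = g %[ae mu in D] -> cintegral D f = cintegral D g.
Proof.
move=> mD [rf jf] [rg jg] fg; congr Complex; congr fine.
  apply: ae_eq_integral => //; [exact/measurable_EFinP|exact/measurable_EFinP|].
  by apply: filterS fg => x /[apply] ->.
apply: ae_eq_integral => //; [exact/measurable_EFinP|exact/measurable_EFinP|].
by apply: filterS fg => x /[apply] ->.
Qed.

Section linearity.
Variables (D : set Rn) (mD : measurable D).

Lemma eq_cintegrable f g : (forall x, D x -> f x = g x) ->
  cintegrable D f -> cintegrable D g.
Proof.
by move=> fg [rf jf]; split; [apply: eq_integrable rf|apply: eq_integrable jf] => //
  x /set_mem Dx /=; rewrite fg.
Qed.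

Lemma cintegrableD f g : cintegrable D f -> cintegrable D g ->
  cintegrable D (fun x => f x + g x).
Proof.
move=> [rf jf] [rg jg]; split.
  have := integrableD mD rf rg; apply: eq_integrable => // x _ /=; by rewrite ReD.
have := integrableD mD jf jg; apply: eq_integrable => // x _ /=; by rewrite ImD.
Qed.

Lemma cintegralD f g : cintegrable D f -> cintegrable D g ->
  cintegral D (fun x => f x + g x) = cintegral D f + cintegral D g.
Proof.
move=> [rf jf] [rg jg]; apply: complex_ext; rewrite ?ReD ?ImD /cintegral /=.
  by rewrite -RintegralD//; apply: eq_Rintegral => x _; rewrite ReD.
by rewrite -RintegralD//; apply: eq_Rintegral => x _; rewrite ImD.
Qed.

Lemma integrableZ_real (r : R) (h : Rn -> R) : mu.-integrable D (EFin \o h) ->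
  mu.-integrable D (EFin \o (fun x => r * h x)).
Proof. by move=> ih; have := integrableZl mD r ih; apply: eq_integrable. Qed.

Lemma cintegrableZ (c : C) f : cintegrable D f -> cintegrable D (fun x => c * f x).
Proof.
move=> [rf jf]; split.
  have := integrableB mD (integrableZ_real (Re c) rf) (integrableZ_real (Im c) jf).
  by apply: eq_integrable => // x _ /=; rewrite ReM.
have := integrableD mD (integrableZ_real (Re c) jf) (integrableZ_real (Im c) rf).
by apply: eq_integrable => // x _ /=; rewrite ImM.
Qed.

Lemma cintegralZ (c : C) f : cintegrable D f ->
  cintegral D (fun x => c * f x) = c * cintegral D f.
Proof.
move=> [rf jf]; apply: complex_ext; rewrite ?ReM ?ImM /cintegral /=.
  rewrite -!RintegralZl// -RintegralB; [|by []|exact: integrableZ_real|exact: integrableZ_real].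
  by apply: eq_Rintegral => x _; rewrite ReM.
rewrite -!RintegralZl// -RintegralD; [|by []|exact: integrableZ_real|exact: integrableZ_real].
by apply: eq_Rintegral => x _; rewrite ImM.
Qed.

Lemma cintegral0 : cintegral D (fun=> 0) = 0.
Proof. by rewrite /cintegral /= !Rintegral_cst// mul0r. Qed.

Lemma cintegrable0 : cintegrable D (fun=> 0).
Proof. by split; exact: integrable0. Qed.

Lemma cintegrable_sum (I : finType) (F : I -> Rn -> C) :
  (forall i, cintegrable D (F i)) -> cintegrable D (fun x => \sum_i F i x).
Proof.
move=> iF; have -> : (fun x => \sum_i F i x) = \sum_i F i by apply/funext => x; rewrite fct_sumE.
elim/big_rec : _ => [|i f _ IH]; first exact: cintegrable0.
exact: cintegrableD.
Qed.

Lemma cintegral_sum (I : finType) (F : I -> Rn -> C) :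
  (forall i, cintegrable D (F i)) ->
  cintegral D (fun x => \sum_i F i x) = \sum_i cintegral D (F i).
Proof.
move=> iF; have -> : (fun x => \sum_i F i x) = \sum_i F i by apply/funext => x; rewrite fct_sumE.
suff [] : cintegral D (\sum_i F i) = \sum_i cintegral D (F i) /\ cintegrable D (\sum_i F i) by [].
elim/big_rec2 : _ => [|i c f _ [IH1 IH2]]; first by split; [exact: cintegral0|exact: cintegrable0].
by split; [rewrite -IH1; exact: cintegralD|exact: cintegrableD].
Qed.

Lemma cintegrable_conj f : cintegrable D f -> cintegrable D (fun x => (f x)^*).
Proof.
move=> [rf jf]; split; first by apply: eq_integrable rf => // x _ /=; rewrite Re_conj.
have := integrableN jf; apply: eq_integrable => // x _ /=; by rewrite Im_conj.
Qed.

Lemma cintegral_conj f : cintegrable D f ->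
  cintegral D (fun x => (f x)^*) = (cintegral D f)^*.
Proof.
move=> [rf jf]; apply: complex_ext; rewrite ?Re_conj ?Im_conj /cintegral /=.
  by apply: eq_Rintegral => x _; rewrite Re_conj.
rewrite -mulN1r -RintegralZl//; apply: eq_Rintegral => x _; by rewrite Im_conj mulN1r.
Qed.

Lemma L2_cmeasurable f : L2 D f -> cmeasurable D f. Proof. by case. Qed.

Lemma L2_integrable_sqr f : L2 D f ->
  mu.-integrable D (EFin \o (fun x => Re (f x) ^+ 2 + Im (f x) ^+ 2)).
Proof.
move=> [rf jf foo]; apply/integrableP; split.
  by apply/measurable_EFinP/measurable_funD; exact: measurable_funX.
apply: le_lt_trans foo; rewrite le_eqVlt; apply/orP; left; apply/eqP.
apply: eq_integral => x _ /=; rewrite normc_sqr ger0_norm//.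
by rewrite addr_ge0 ?sqr_ge0.
Qed.

Lemma L2_mul f g : L2 D f -> L2 D g -> cintegrable D (fun x => f x * g x).
Proof.
move=> Lf Lg.
have [rm jm] := cmeasurableM (L2_cmeasurable Lf) (L2_cmeasurable Lg).
have i2 := integrableD mD (L2_integrable_sqr Lf) (L2_integrable_sqr Lg).
(* Both the real and the imaginary part of a product have this shape. *)
have key (a b c d : R) : `|a * c - b * d| <= a ^+ 2 + b ^+ 2 + (c ^+ 2 + d ^+ 2).
  have := (sqr_ge0 (a - c), sqr_ge0 (b + d), sqr_ge0 (a + c), sqr_ge0 (b - d)).
  have := (sqr_ge0 a, sqr_ge0 b, sqr_ge0 c, sqr_ge0 d).
  rewrite !expr2 => -[[[? ?] ?] ?] [[[? ?] ?] ?].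
  by rewrite ler_norml; apply/andP; split; lra.
split; apply: (le_integrable mD _ _ i2); try exact/measurable_EFinP.
  move=> x Dx /=; rewrite ReM lee_fin [leRHS]ger0_norm ?key//.
  by rewrite !addr_ge0 ?sqr_ge0.
move=> x Dx /=; rewrite ImM lee_fin [leRHS]ger0_norm; last by rewrite !addr_ge0 ?sqr_ge0.
have := key (Re (f x)) (- Im (f x)) (Im (g x)) (Re (g x)).
by rewrite mulNr opprK sqrrN [in leRHS](addrC (Im (g x) ^+ 2)).
Qed.

Lemma L2_conj f : L2 D f -> L2 D (fun x => (f x)^*).
Proof.
move=> Lf; have [rm jm] := cmeasurable_conj (L2_cmeasurable Lf).
split => //; have [_ _] := Lf; apply: le_lt_trans.
rewrite le_eqVlt; apply/orP; left; apply/eqP; apply: eq_integral => x _.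
by rewrite !normc_sqr Re_conj Im_conj sqrrN.
Qed.

Lemma L2_bounded f (M : R) : (mu D < +oo)%E -> cmeasurable D f ->
  (forall x, D x -> Re (f x) ^+ 2 + Im (f x) ^+ 2 <= M) -> L2 D f.
Proof.
move=> Doo [rf jf] fM; split => //.
apply: (@le_lt_trans _ _ (\int[mu]_(x in D) (cst M%:E x))%E).
  apply: ge0_le_integral => //.
  - by move=> x _; rewrite lee_fin sqr_ge0.
  - under eq_fun do rewrite normc_sqr.
    by apply/measurable_EFinP/measurable_funD; exact: measurable_funX.
  - by move=> x Dx; rewrite lee_fin normc_sqr; exact: fM.
have [->|/set0P[x Dx]] := eqVneq D set0; first by rewrite integral_set0 ltry.
rewrite integral_cst//; apply: lte_mul_pinfty => //.
by rewrite lee_fin; apply: le_trans (fM _ Dx); rewrite addr_ge0 ?sqr_ge0.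
Qed.

Lemma L2_cintegrable f : (mu D < +oo)%E -> L2 D f -> cintegrable D f.
Proof.
move=> Doo Lf.
have L1 : L2 D (fun=> 1).
  by apply: (@L2_bounded _ 1) => // x _ /=; rewrite expr1n expr0n addr0.
by have := L2_mul Lf L1; apply: eq_cintegrable => x _; rewrite mulr1.
Qed.

Lemma cintegral_norm0 f : L2 D f -> cintegral D (fun x => f x * (f x)^*) = 0 ->
  f = (fun=> 0) %[ae mu in D].
Proof.
move=> Lf [+ _]; rewrite /Rintegral => f0.
have i2 := L2_integrable_sqr Lf.
have i0 : (\int[mu]_(x in D) `|(Re (f x) ^+ 2 + Im (f x) ^+ 2)%:E| = 0)%E.
  rewrite -[LHS]fineK; last first.
    by apply: integrable_fin_num => //; exact: integrable_abse.
  rewrite -[X in _ = X]/(0%:E) -f0; congr (fine _)%:E; apply: eq_integral => x _ /=.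
  rewrite ger0_norm ?addr_ge0 ?sqr_ge0// ReM Re_conj Im_conj mulrN opprK.
  by rewrite -!expr2.
have : ae_eq mu D (EFin \o (fun x => Re (f x) ^+ 2 + Im (f x) ^+ 2)) (cst 0%E).
  by apply/ae_eq_integral_abs => //; exact: measurable_int i2.
apply: filterS => x /[apply] -[] /eqP; rewrite paddr_eq0 ?sqr_ge0// !sqrf_eq0.
by move=> /andP[/eqP r0 /eqP j0]; apply: complex_ext.
Qed.

End linearity.

Lemma ctest_separate D h : open D -> cintegrable D h ->
  (forall g : Rn -> R, test_fun D g -> cintegral D (fun x => h x * (g x)%:C) = 0) ->
  h = (fun=> 0) %[ae mu in D].
Proof.
move=> oD [rh jh] h0.
have r0 : (fun x => Re (h x)) = cst 0 %[ae mu in D].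
  apply: test_fun_separate => // g tg.
  transitivity (Re (cintegral D (fun x => h x * (g x)%:C))); last by rewrite h0.
  by apply: eq_Rintegral => x _; rewrite ReM /= mulr0 subr0.
have j0 : (fun x => Im (h x)) = cst 0 %[ae mu in D].
  apply: test_fun_separate => // g tg.
  transitivity (Im (cintegral D (fun x => h x * (g x)%:C))); last by rewrite h0.
  by apply: eq_Rintegral => x _; rewrite ImM /= mulr0 add0r.
by apply: filterS2 r0 j0 => x + + Dx => /(_ Dx) ? /(_ Dx) ?; exact: complex_ext.
Qed.

End complex_integral.

(** * Characters of the additive group of row vectors *)

Section characters.
Variables (R : realType).
Local Notation C := R[i].
Local Notation Re := (@complex.Re R).
Local Notation Im := (@complex.Im R).

Definition expi (t : R) : C := cos t +i* sin t.

Lemma expi0 : expi 0 = 1. Proof. by rewrite /expi cos0 sin0. Qed.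

Lemma expiD s t : expi (s + t) = expi s * expi t.
Proof.
by apply: complex_ext; rewrite ?ReM ?ImM /= ?cosD ?sinD// addrC.
Qed.

Lemma expiN t : expi (- t) = (expi t)^*.
Proof. by rewrite /expi cosN sinN. Qed.

Lemma expiK t : expi t * (expi t)^* = 1.
Proof. by rewrite -expiN -expiD subrr expi0. Qed.

Lemma expi_neq0 t : expi t != 0.
Proof.
by apply/eqP => t0; have := expiK t; rewrite t0 mul0r => /eqP; rewrite eq_sym oner_eq0.
Qed.

Lemma cexpi t : cexp ('i%C * t%:C) = expi t.
Proof.
rewrite /cexp (_ : 'i%C * t%:C = 0 +i* t); last first.
  by apply: complex_ext; rewrite ?ReM ?ImM /=; ring.
by rewrite /= expR0; apply: complex_ext; rewrite ?ReM ?ImM /=; ring.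
Qed.

Lemma unit_sqr (z : C) : z * z^* = 1 -> Re z ^+ 2 + Im z ^+ 2 = 1.
Proof. by move=> /(congr1 Re); rewrite ReM Re_conj Im_conj /= mulrN opprK. Qed.

Lemma unit_expi (z : C) : z * z^* = 1 -> 0 < Re z ->
  exists2 t, - (pi / 2) <= t <= pi / 2 & z = expi t.
Proof.
move=> /unit_sqr z1 z0.
have jz : -1 <= Im z <= 1.
  by apply/andP; split; have := sqr_ge0 (Re z); nra.
exists (asin (Im z)); first by rewrite asin_geNpi2// asin_lepi2.
apply: complex_ext; rewrite /expi /=; last by rewrite asinK// in_itv.
by rewrite cos_asin// -z1 addrK sqrtr_sqr gtr0_norm.
Qed.

Lemma eq_of_sqr (z w : C) : 0 < Re z -> 0 < Re w -> z * z = w * w -> z = w.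
Proof.
move=> z0 w0 zw; have : (z - w) * (z + w) == 0 by rewrite -subr_sqr !expr2 zw subrr.
rewrite mulf_eq0 subr_eq0 => /orP[/eqP//|/eqP/(congr1 Re)].
by rewrite ReD /= => h; exfalso; lra.
Qed.

(** The branch of the square root with positive real part fixes the values at
    all dyadic multiples of a small [dlt]; continuity at 0 does the rest. *)
Lemma local_character1 (e : R) (phi : R -> C) : 0 < e ->
  (forall s t, `|s| < e -> `|t| < e -> `|s + t| < e -> phi (s + t) = phi s * phi t) ->
  (forall t, `|t| < e -> phi t * (phi t)^* = 1) ->
  {for 0, continuous (fun t => Re (phi t))} ->
  {for 0, continuous (fun t => Im (phi t))} ->
  exists w, forall t, `|t| < e -> phi t = expi (w * t).
Proof.
move=> e0 phiD phi1 rphi jphi.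
have phi0 : phi 0 = 1.
  have n0 : `|0 : R| < e by rewrite normr0.
  have p00 := phiD 0 0 n0 n0; rewrite addr0 in p00.
  have /phi1 := n0; rewrite {1}p00 // -mulrA phi1// mulr1; exact.
have phiN t : `|t| < e -> phi (- t) = (phi t)^*.
  move=> te; have := phiD t (- t) te; rewrite normrN subrr normr0 => /(_ te e0).
  rewrite phi0 => tt; by rewrite -[LHS]mul1r -(phi1 t te) mulrAC -tt mul1r.
have [dlt dlt0 [dlte dltP]] : exists2 dlt, 0 < dlt &
    dlt < e /\ forall t, `|t| <= dlt -> 0 < Re (phi t).
  have : nbhs (0 : R) [set t | 0 < Re (phi t)].
    apply: (rphi [set u | 0 < u]); rewrite phi0 /=; apply: open_nbhs_nbhs.
    by split; [exact: open_gt|exact: ltr01].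
  move=> /nbhs_ballP[d /= d0 dP].
  exists (Num.min (d / 2) (e / 2)); first by rewrite lt_min !divr_gt0.
  split=> [|t]; first by rewrite gt_min; apply/orP; right; lra.
  rewrite le_min => /andP[td _]; apply: dP; rewrite /ball/= sub0r normrN; lra.
have [th thP phid] : exists2 t, - (pi / 2) <= t <= pi / 2 & phi dlt = expi t.
  by apply: unit_expi; [apply: phi1|apply: dltP]; rewrite gtr0_norm.
pose w := th / dlt.
have wd : w * dlt = th by rewrite divfK// gt_eqF.
have p2 (k : nat) : 0 < 2 ^- k :> R by rewrite invr_gt0 exprn_gt0.
have p2le (k : nat) : 2 ^- k <= 1 :> R.
  by rewrite invf_le1 ?exprn_gt0// exprn_ege1// ler1n.
have dyad k : phi (dlt * 2 ^- k) = expi (w * (dlt * 2 ^- k)).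
  elim: k => [|k IH]; first by rewrite expr0 invr1 mulr1 wd.
  have half : dlt * 2 ^- k = dlt * 2 ^- k.+1 + dlt * 2 ^- k.+1.
    by rewrite -mulrDr exprS invfM; congr (_ * _); field.
  have dk : `|dlt * 2 ^- k.+1| <= dlt.
    by rewrite ger0_norm ?ler_piMr// ltW// mulr_gt0.
  have dk' : `|dlt * 2 ^- k| <= dlt.
    by rewrite ger0_norm ?ler_piMr// ltW// mulr_gt0.
  apply: eq_of_sqr; first exact: dltP.
    rewrite /= mulrA wd exprS invfM; apply: cos_gt0_pihalf.
    have := p2 k; have := p2le k; have := pi_gt0 R.
    by move: thP => /andP[]; move: (pi : R) (2 ^- k) => p q *; apply/andP; split; nra.
  rewrite -expiD -mulrDr -half -IH half phiD// -?half; exact: le_lt_trans dlte.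
have mult k (m : nat) : m%:R * (dlt * 2 ^- k) < e ->
    phi (m%:R * (dlt * 2 ^- k)) = expi (w * (m%:R * (dlt * 2 ^- k))).
  have d0 : 0 < dlt * 2 ^- k by rewrite mulr_gt0.
  elim: m => [|m IH] me; first by rewrite mul0r mulr0 phi0 expi0.
  have mS : m.+1%:R * (dlt * 2 ^- k) = m%:R * (dlt * 2 ^- k) + dlt * 2 ^- k.
    by rewrite -[m.+1%:R]natr1 mulrDl mul1r.
  have m0 : 0 <= m%:R * (dlt * 2 ^- k) by rewrite mulr_ge0// ltW.
  have me' : m%:R * (dlt * 2 ^- k) < e by lra.
  rewrite mS phiD ?IH ?dyad -?expiD -?mulrDr// ger0_norm//; lra.
exists w.
suff pos t : 0 <= t -> t < e -> phi t = expi (w * t).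
  move=> t te; have [t0|t0] := leP 0 t; first by apply: pos; rewrite // -(ger0_norm t0).
  have te' : - t < e by rewrite -(ltr0_norm t0).
  have := pos (- t) ltac:(lra) te'; rewrite phiN// mulrN expiN => /(congr1 Num.conj).
  by rewrite !conjCK.
move=> t0 te.
pose psi s := expi (- (w * s)) * phi s.
suff : psi t = 1.
  by rewrite /psi => /(congr1 ( *%R (expi (w * t)))); rewrite mulrA -expiD subrr expi0 mul1r mulr1.
have psi1 : psi t * (psi t)^* = 1.
  by rewrite /psi rmorphM mulrACA expiK phi1 ?mulr1// ger0_norm.
(* [psi] is 1 at dyadic multiples of [dlt], so [psi t] is also a value of [psi]
   arbitrarily close to 0. *)
have small k : exists2 s, 0 <= s < dlt * 2 ^- k & psi t = psi s.
  have d0 : 0 < dlt * 2 ^- k by rewrite mulr_gt0.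
  pose m := Num.truncn (t / (dlt * 2 ^- k)).
  have td0 : 0 <= t / (dlt * 2 ^- k) by rewrite divr_ge0// ltW.
  have /andP[] := truncn_itv td0.
  rewrite -/m ler_pdivlMr// ltr_pdivrMr// -[m.+1%:R]natr1 mulrDl mul1r => mt tm.
  have m0 : 0 <= m%:R * (dlt * 2 ^- k) by rewrite mulr_ge0// ltW.
  exists (t - m%:R * (dlt * 2 ^- k)); first by apply/andP; split; lra.
  have {1}-> : t = m%:R * (dlt * 2 ^- k) + (t - m%:R * (dlt * 2 ^- k)) by rewrite addrC subrK.
  rewrite /psi phiD; first last.
  - by rewrite addrC subrK ger0_norm.
  - rewrite ger0_norm; lra.
  - rewrite ger0_norm; lra.
  rewrite mult; last lra.
  by rewrite mulrA -expiD; congr (expi _ * _); ring.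
have cpsi : {for 0, continuous (fun s => Re (psi s))}.
  rewrite (_ : (fun s => Re (psi s)) =
      fun s => cos (- (w * s)) * Re (phi s) - sin (- (w * s)) * Im (phi s)); last first.
    by apply/funext => s; rewrite /psi ReM.
  have cw : {for 0, continuous (fun s : R => - (w * s))}.
    by apply: cvgN; apply: cvgM; [exact: cvg_cst|exact: cvg_id].
  have h0 : - (w * 0) = 0 by rewrite mulr0 oppr0.
  apply: cvgB; apply: cvgM => //.
    by apply: (continuous_comp cw); exact: continuous_cos.
  by apply: (continuous_comp cw); exact: continuous_sin.
have repsi : Re (psi t) = 1.
  apply/eqP; rewrite eq_le; apply/andP; split.
    by have := unit_sqr psi1; have := sqr_ge0 (Im (psi t)); nra.
  apply/ler_addgt0Pr => eps eps0.
  have : nbhs (0 : R) [set s | 1 - eps < Re (psi s)].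
    apply: (cpsi [set u | 1 - eps < u]); apply: open_nbhs_nbhs.
    split; first exact: open_gt.
    by rewrite /psi /= mulr0 oppr0 expi0 phi0 mulr1 /=; lra.
  move=> /nbhs_ballP[d /= d0 dP].
  have [k kd] : exists k, dlt * 2 ^- k < d.
    have [k _ /(_ k (leqnn k))] := near_infty_natSinv_expn_lt (PosNum (divr_gt0 d0 dlt0)).
    rewrite /= ltr_pdivlMr// mulrC => kd; exists k.
    by move: kd; rewrite div1r.
  have [s /andP[s0 sd] ->] := small k.
  have : 1 - eps < Re (psi s) by apply: dP; rewrite /ball /= sub0r normrN ger0_norm//; lra.
  lra.
apply: complex_ext; rewrite ?repsi//=.
by have := unit_sqr psi1; rewrite repsi expr1n -[RHS]addr0 => /addrI/eqP; rewrite sqrf_eq0 => /eqP.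
Qed.

End characters.

Section plane_waves.
Variables (R : realType) (n : nat).
Local Notation C := R[i].
Local Notation Rn := 'rV[R]_n.
Local Notation Re := (@complex.Re R).
Local Notation Im := (@complex.Im R).

Lemma dotpDr (a x y : Rn) : dotp a (x + y) = dotp a x + dotp a y.
Proof. by rewrite /dotp -big_split; apply: eq_bigr => i _; rewrite mxE mulrDr. Qed.

Lemma dotpNr (a x : Rn) : dotp a (- x) = - dotp a x.
Proof. by rewrite /dotp -sumrN; apply: eq_bigr => i _; rewrite mxE mulrN. Qed.

Lemma dotpBl (a b x : Rn) : dotp (a - b) x = dotp a x - dotp b x.
Proof. by rewrite /dotp -sumrB; apply: eq_bigr => i _; rewrite !mxE mulrBl. Qed.

Lemma dotpZr (a x : Rn) t : dotp a (t *: x) = t * dotp a x.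
Proof. by rewrite /dotp mulr_sumr; apply: eq_bigr => i _; rewrite mxE mulrCA. Qed.

Lemma dotp_gt0 (a : Rn) : a != 0 -> 0 < dotp a a.
Proof.
move=> a0; rewrite lt_neqAle sumr_ge0 ?andbT => [|i _]; last by rewrite -expr2 sqr_ge0.
apply: contra a0; rewrite eq_sym psumr_eq0 => [|i _]; last by rewrite -expr2 sqr_ge0.
move=> /allP h; apply/eqP/rowP => i; rewrite mxE.
by have := h i (mem_index_enum _); rewrite mulf_eq0 orbb => /eqP.
Qed.

Definition plane_wave (xi x : Rn) : C := expi (dotp xi x).

Lemma plane_waveD xi x y : plane_wave xi (x + y) = plane_wave xi x * plane_wave xi y.
Proof. by rewrite /plane_wave dotpDr expiD. Qed.

Lemma plane_waveN xi x : plane_wave xi (- x) = (plane_wave xi x)^*.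
Proof. by rewrite /plane_wave dotpNr expiN. Qed.

Lemma plane_waveB xi x y : plane_wave xi (x - y) = plane_wave xi x * (plane_wave xi y)^*.
Proof. by rewrite plane_waveD plane_waveN. Qed.

Lemma dotp_continuous (xi : Rn) : continuous (dotp xi).
Proof.
apply: lipschitz_continuous; exists (\sum_m `|xi 0 m|) => x y.
rewrite -[in leLHS]mulN1r -dotpZr scaleN1r -dotpDr /dotp mulr_suml.
apply: le_trans (ler_norm_sum _ _ _) _; apply: ler_sum => m _.
by rewrite normrM ler_wpM2l// coord_rV_le_norm.
Qed.

Lemma plane_wave_continuous xi :
  continuous (fun x => Re (plane_wave xi x)) /\
  continuous (fun x => Im (plane_wave xi x)).
Proof.
split=> x; apply: (continuous_comp (dotp_continuous (x := x))).
  exact: continuous_cos.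
exact: continuous_sin.
Qed.

Lemma plane_wave_cmeasurable (D : set Rn) xi : cmeasurable D (plane_wave xi).
Proof.
have [c1 c2] := plane_wave_continuous xi.
split; apply: (@measurable_funS _ _ _ _ setT) => //.
  by apply: measurable_continuous_rV => [|x _]; [exact: openT|exact: c1].
by apply: measurable_continuous_rV => [|x _]; [exact: openT|exact: c2].
Qed.

(** Along the direction [xi - eta] the quotient of the two waves is
    [t |-> e^(i t s)] with [s > 0], which differs from 1 for all small [t > 0]. *)
Lemma plane_wave_neq (xi eta : Rn) (e : R) : 0 < e -> xi != eta ->
  exists2 h, `|h| < e & plane_wave xi h != plane_wave eta h.
Proof.
move=> e0 xieta; have d0 : 0 < dotp (xi - eta) (xi - eta) by rewrite dotp_gt0// subr_eq0.
set s := dotp _ _ in d0; set N := `|xi - eta|.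
have N0 : 0 <= N by exact: normr_ge0.
have B0 : 0 < s + 1 + (N + 1) / e by rewrite !addr_gt0// divr_gt0// ltr_wpDl.
pose t := (s + 1 + (N + 1) / e)^-1.
have t0 : 0 < t by rewrite invr_gt0.
have ts1 : t * s < 1.
  rewrite mulrC ltr_pdivrMr// mul1r -addrA ltrDl addr_gt0// divr_gt0//; lra.
exists (t *: (xi - eta)).
  rewrite normrZ (ger0_norm (ltW t0)) mulrC ltr_pdivrMr// mulrDr mulrCA divff ?gt_eqF//.
  have : 0 < e * (s + 1) by rewrite mulr_gt0// addr_gt0.
  rewrite -/N; move: (e * (s + 1)) => z *; lra.
apply/eqP => E; have : expi (t * s) = 1.
  rewrite /s -dotpZr dotpBl expiD expiN -/(plane_wave xi _) E.
  exact: expiK.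
move=> /(congr1 Im) /= sts; have : 0 < sin (t * s).
  apply: sin_gt0_pi; apply/andP; split; first by rewrite mulr_gt0.
  have := pi_ge2 R; lra.
by rewrite sts ltxx.
Qed.

(** Dedekind's argument on a shrinking neighbourhood: translating a relation by
    a small [h] and subtracting a multiple of it eliminates the first wave, and
    keeps the coefficient of another one up to a factor which is nonzero for a
    suitable [h]. *)
Lemma plane_wave_indep (p : nat) (xi : 'I_p -> Rn) (U : set Rn) (a : 'I_p -> C) :
  injective xi -> open U -> U !=set0 ->
  (forall x, U x -> \sum_k a k * plane_wave (xi k) x = 0) -> forall k, a k = 0.
Proof.
elim: p xi U a => [|p IH] xi U a ixi oU U0 aU k; first by case: k.
have [x Ux] := U0.
have [e /= e0 eU] : exists2 e : R, 0 < e & ball x e `<=` U.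
  by move: oU; rewrite openE => /(_ _ Ux) /nbhs_ballP.
have a_lift j : a (lift ord0 j) = 0.
  have xij : xi (lift ord0 j) != xi ord0.
    by apply/eqP => /ixi /eqP; rewrite eq_sym (negPf (neq_lift _ _)).
  have [h he] := plane_wave_neq (divr_gt0 e0 (ltr0Sn R 1)) xij.
  have := IH (fun j => xi (lift ord0 j)) (ball x (e / 2))
    (fun j => a (lift ord0 j) * (plane_wave (xi (lift ord0 j)) h - plane_wave (xi ord0) h)).
  move=> /(_ _ _ _ _ j) H; rewrite -subr_eq0 => hN0.
  have /eqP : a (lift ord0 j) * (plane_wave (xi (lift ord0 j)) h - plane_wave (xi ord0) h) = 0.
    apply: H.
    - by move=> j1 j2 /ixi /lift_inj.
    - by apply: ball_open; exact: divr_gt0.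
    - by exists x; apply: ballxx; exact: divr_gt0.
    - move=> y xy.
      have Uy : U y.
        by apply: eU; apply: le_ball xy; lra.
      have Uyh : U (y + h).
        apply: eU; move: xy; rewrite -!ball_normE /= => xy.
        rewrite opprD addrA (splitr e) (le_lt_trans (ler_normB _ _))// ltrD//.
      have := aU _ Uyh; have := congr1 ( *%R (plane_wave (xi ord0) h)) (aU _ Uy).
      rewrite mulr0 !big_ord_recl /= => E1 E2.
      set c0 := plane_wave (xi ord0) h in E1 *.
      have S12 : \sum_(i < p) a (lift ord0 i) * plane_wave (xi (lift ord0 i)) (y + h) =
          c0 * \sum_(i < p) a (lift ord0 i) * plane_wave (xi (lift ord0 i)) y.
        apply/eqP; rewrite -subr_eq0 -[X in _ == X]E2 -[X in _ == X]subr0.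
        rewrite -[X in _ == _ - X]E1 plane_waveD -/c0; apply/eqP; ring.
      transitivity (\sum_(i < p) a (lift ord0 i) * plane_wave (xi (lift ord0 i)) (y + h) -
          c0 * \sum_(i < p) a (lift ord0 i) * plane_wave (xi (lift ord0 i)) y).
        rewrite mulr_sumr -sumrB; apply: eq_bigr => i _.
        by rewrite plane_waveD; ring.
      by rewrite S12 subrr.
  by rewrite mulf_eq0 (negPf hN0) orbF => /eqP.
case: (unliftP ord0 k) => [j ->|->]; first exact: a_lift.
have := aU _ Ux; rewrite big_ord_recl big1 ?addr0 => [/eqP|j _].
  by rewrite mulf_eq0 (negPf (expi_neq0 _)) orbF => /eqP.
by rewrite a_lift mul0r.
Qed.

(** The sup norm keeps the partial sums of the coordinate decomposition of [h]
    in the same ball, so one coordinate can be added at a time. *)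
Lemma local_character (e : R) (phi : Rn -> C) : 0 < e ->
  (forall s t, `|s| < e -> `|t| < e -> `|s + t| < e -> phi (s + t) = phi s * phi t) ->
  (forall t, `|t| < e -> phi t * (phi t)^* = 1) ->
  {for 0, continuous (fun t => Re (phi t))} ->
  {for 0, continuous (fun t => Im (phi t))} ->
  exists xi, forall t, `|t| < e -> phi t = plane_wave xi t.
Proof.
move=> e0 phiD phi1 rphi jphi.
have normd m (t : R) : `|t *: delta_mx 0 m : Rn| < e <-> `|t| < e.
  split => [/(norm_rV_ltP _ e0)/(_ m)|te]; first by rewrite !mxE !eqxx mulr1.
  apply/(norm_rV_ltP _ e0) => i; rewrite !mxE eqxx /=.
  by case: eqP => _; rewrite ?mulr1// mulr0 normr0.
have cline m : {for (0 : R), continuous (fun t : R => t *: (delta_mx 0 m : Rn))}.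
  exact: scalel_continuous.
have /choice [w wP] : forall m : 'I_n, exists w, forall t : R, `|t| < e ->
    phi (t *: delta_mx 0 m) = expi (w * t).
  move=> m; apply: local_character1 => //.
  - move=> s t /normd-/(_ m) se /normd-/(_ m) te /normd-/(_ m) ste.
    by rewrite scalerDl phiD -?scalerDl.
  - by move=> t /normd-/(_ m) /phi1.
  - apply: (@continuous_comp _ _ _ (fun t : R => t *: (delta_mx 0 m : Rn))
      (fun x => Re (phi x)) _ (cline m)).
    by rewrite scale0r.
  - apply: (@continuous_comp _ _ _ (fun t : R => t *: (delta_mx 0 m : Rn))
      (fun x => Im (phi x)) _ (cline m)).
    by rewrite scale0r.
exists (\row_m w m) => t te.
pose P (k : nat) : Rn := \row_m (if (m < k)%N then t 0 m else 0).
have Pe k : `|P k| < e.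
  apply/(norm_rV_ltP _ e0) => m; rewrite mxE; case: ifP => _; last by rewrite normr0.
  by move/(norm_rV_ltP _ e0) : te; exact.
have phi0 : phi 0 = 1.
  have n0 : `|0 : Rn| < e by rewrite normr0.
  have p00 := phiD 0 0 n0 n0; rewrite addr0 in p00.
  have /phi1 := n0; rewrite {1}p00 // -mulrA phi1// mulr1; exact.
have main k : phi (P k) = expi (\sum_(m < n | (m < k)%N) w m * t 0 m).
  elim: k => [|k IH].
    rewrite big_pred0// expi0 (_ : P 0%N = 0)//.
    by apply/rowP => m; rewrite !mxE.
  have [nk|kn] := leqP n k.
    have -> : P k.+1 = P k.
      by apply/rowP => m; rewrite !mxE !(leq_trans (ltn_ord m))// (leq_trans nk).
    rewrite IH; congr expi; apply: eq_bigl => m.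
    by rewrite !(leq_trans (ltn_ord m))// (leq_trans nk).
  pose m := Ordinal kn.
  have PS : P k.+1 = P k + t 0 m *: delta_mx 0 m.
    apply/rowP => i; rewrite !mxE eqxx /= ltnS leq_eqVlt (_ : (i == m) = (val i == k))//.
    case: eqP => [ik|_] /=; last by rewrite mulr0 addr0.
    by rewrite ik ltnn add0r mulr1; congr (t 0 _); exact: val_inj.
  have tm : `|t 0 m| < e by exact: le_lt_trans (coord_rV_le_norm t m) te.
  rewrite PS phiD ?IH ?wP//; last 2 first.
  - exact/normd.
  - by rewrite -PS.
  rewrite -expiD [in RHS](bigD1 m)//= addrC; congr (expi (_ + _)).
  apply: eq_bigl => i; rewrite ltnS [in RHS]leq_eqVlt.
  by rewrite (_ : (i == m) = (val i == k))//; case: eqP => [->|_] /=; rewrite ?ltnn ?andbT.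
have -> : t = P n by apply/rowP => m; rewrite mxE ltn_ord.
rewrite main /plane_wave; congr expi; rewrite /dotp; apply: eq_big => [m|m _].
  by rewrite ltn_ord.
by rewrite !mxE ltn_ord.
Qed.

End plane_waves.

(** * Simultaneous diagonalization *)

Section adjoint_families.
Variable C : numClosedFieldType.
Local Notation adj M := (map_mx Num.conj M^T).

Lemma adjK m n (A : 'M[C]_(m, n)) : adj (adj A) = A.
Proof. by apply/matrixP => i j; rewrite !mxE conjCK. Qed.

Lemma adjM m n p (A : 'M[C]_(m, n)) (B : 'M[C]_(n, p)) :
  adj (A *m B) = adj B *m adj A.
Proof. by rewrite trmx_mul map_mxM. Qed.

Lemma adjB m n (A B : 'M[C]_(m, n)) : adj (A - B) = adj A - adj B.
Proof. by rewrite linearB /= map_mxB. Qed.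

Lemma mul_adj_eq0 m n (A : 'M[C]_(m, n)) : A *m adj A = 0 -> A = 0.
Proof.
move=> A0; apply/matrixP => i j; have /matrixP/(_ i i) := A0.
rewrite !mxE => /eqP; rewrite psumr_eq0 => [/allP/(_ j (mem_index_enum _))|k _].
  by rewrite !mxE mulf_eq0 conjC_eq0 orbb => /eqP.
by rewrite !mxE mul_conjC_ge0.
Qed.

(** A family of vectors of maximal rank spans all the others. *)
Lemma finite_row_span (F : fieldType) (T : Type) (P : T -> Prop) m (v : T -> 'rV[F]_m) :
  exists p (y : 'I_p -> T), (forall i, P (y i)) /\
    forall x, P x -> (v x <= \matrix_i v (y i))%MS.
Proof.
pose Q k := `[< exists p (y : 'I_p -> T), (forall i, P (y i)) /\
   \rank (\matrix_i v (y i)) = k >].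
have Q0 : exists k, Q k.
  have y0 : 'I_0 -> T by move=> [].
  by exists (\rank (\matrix_i v (y0 i))); apply/asboolP; exists 0%N, y0; split; first by case.
have Qm k : Q k -> (k <= m)%N.
  by move=> /asboolP[p [y [_ <-]]]; exact: rank_leq_col.
case: (ex_maxnP Q0 Qm) => k /asboolP[p [y [Py yk]]] kmax.
exists p, y; split => // x Px; apply/negPn/negP => nx.
pose y' (i : 'I_p.+1) := oapp y x (unlift ord0 i).
have Py' i : P (y' i) by rewrite /y'; case: unliftP => [j _|_] //=; exact: Py.
have sub i j : y' i = j -> (v j <= \matrix_i v (y' i))%MS.
  by move=> <-; rewrite -(rowK (fun i => v (y' i)) i) row_sub.
have lt : (\matrix_i v (y i) < \matrix_i v (y' i))%MS.
  apply/andP; split.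
    apply/row_subP => i; rewrite rowK; apply: (sub (lift ord0 i)).
    by rewrite /y' liftK.
  apply: contra nx => /(submx_trans _); apply; apply: (sub ord0).
  by rewrite /y' unlift_none.
have := rank_ltmx lt; rewrite yk ltnNge => /negP; apply; apply: kmax.
by apply/asboolP; exists p.+1, y'.
Qed.

(** Unitary triangularization of a finite spanning subfamily triangularizes
    every member together with its adjoint. *)
Lemma commuting_adjoint_diag m (T : Type) (P : T -> Prop) (U : T -> 'M[C]_m) :
  (forall s t, P s -> P t -> U s *m U t = U t *m U s) ->
  (forall t, P t -> exists2 t', P t' & U t' = adj (U t)) ->
  exists2 S : 'M[C]_m, S *m adj S = 1%:M &
    forall t, P t -> is_diag_mx (S *m U t *m adj S).
Proof.
move=> comU adjU.
have [p [y [Py yspan]]] := finite_row_span P (fun t => mxvec (U t)).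
have [|S Sunit /allP Strig] := @cotrigonalization C m [seq U (y i) | i <- enum 'I_p].
  by move=> A B /mapP[i _ ->] /mapP[j _ ->]; exact: comU.
exists S; first exact/unitarymxP.
have Su := unitarymx_unit Sunit.
have trig t : P t -> is_trig_mx (S *m U t *m adj S).
  move=> /yspan /submxP[D UD].
  have {UD}-> : U t = \sum_i D 0 i *: U (y i).
    rewrite -[LHS]mxvecK UD mulmx_sum_row linear_sum /=; apply: eq_bigr => i _.
    by rewrite rowK linearZ /= mxvecK.
  apply/is_trig_mxP => i j ij.
  rewrite mulmx_sumr mulmx_suml summxE big1// => k _.
  rewrite -scalemxAr -scalemxAl mxE.
  have : is_trig_mx (conjmx S (U (y k))) by apply: Strig; apply: map_f; rewrite mem_enum.
  rewrite conjumx// invmx_unitary// => /is_trig_mxP ->//; exact: mulr0.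
move=> t Pt; apply/is_diag_mxP => i j; case: ltngtP => // ij _.
  by have /is_trig_mxP -> := trig t Pt.
have [t' Pt' Ut'] := adjU t Pt.
have /is_trig_mxP/(_ j i ij) := trig t' Pt'.
rewrite Ut' (_ : S *m _ *m _ = adj (S *m U t *m adj S)); last first.
  by rewrite !adjM adjK mulmxA.
by rewrite !mxE => /eqP; rewrite conjC_eq0 => /eqP.
Qed.

End adjoint_families.

(** * Translation-invariant kernels of finite rank *)

Section translation_invariant_kernel.
Variables (R : realType) (n m : nat).
Local Notation C := R[i].
Local Notation Rn := 'rV[R]_n.
Local Notation Re := (@complex.Re R).
Local Notation Im := (@complex.Im R).
Local Notation adj M := (map_mx Num.conj M^T).

Definition ccontinuous_at (f : Rn -> C) (x : Rn) :=
  {for x, continuous (fun t => Re (f t))} /\ {for x, continuous (fun t => Im (f t))}.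

Lemma ccontinuous_atD f g x : ccontinuous_at f x -> ccontinuous_at g x ->
  ccontinuous_at (fun t => f t + g t) x.
Proof.
move=> [rf jf] [rg jg]; split.
  rewrite (_ : (fun t => _) = (fun t => Re (f t)) \+ (fun t => Re (g t))).
    exact: continuousD.
  by apply/funext => t; rewrite ReD.
rewrite (_ : (fun t => _) = (fun t => Im (f t)) \+ (fun t => Im (g t))).
  exact: continuousD.
by apply/funext => t; rewrite ImD.
Qed.

Lemma ccontinuous_atM f g x : ccontinuous_at f x -> ccontinuous_at g x ->
  ccontinuous_at (fun t => f t * g t) x.
Proof.
move=> [rf jf] [rg jg]; split.
  rewrite (_ : (fun t => _) = (fun t => Re (f t)) \* (fun t => Re (g t)) \-
      (fun t => Im (f t)) \* (fun t => Im (g t))).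
    by apply: continuousB; exact: continuousM.
  by apply/funext => t; rewrite ReM.
rewrite (_ : (fun t => _) = (fun t => Re (f t)) \* (fun t => Im (g t)) \+
      (fun t => Im (f t)) \* (fun t => Re (g t))).
  by apply: continuousD; exact: continuousM.
by apply/funext => t; rewrite ImM.
Qed.

Lemma ccontinuous_at_cst (c : C) x : ccontinuous_at (fun=> c) x.
Proof. by split; apply: cst_continuous. Qed.

Lemma ccontinuous_at_conj f x : ccontinuous_at f x -> ccontinuous_at (fun t => (f t)^*) x.
Proof.
move=> [rf jf]; split.
  by rewrite (_ : (fun t => _) = fun t => Re (f t))//; apply/funext => t; rewrite Re_conj.
rewrite (_ : (fun t => _) = \- (fun t => Im (f t))); first exact: continuousN.
by apply/funext => t; rewrite Im_conj.
Qed.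

Lemma ccontinuous_at_sum (I : finType) (F : I -> Rn -> C) x :
  (forall i, ccontinuous_at (F i) x) -> ccontinuous_at (fun t => \sum_i F i t) x.
Proof.
move=> cF; have -> : (fun t => \sum_i F i t) = \sum_i F i by apply/funext => t; rewrite fct_sumE.
elim/big_rec : _ => [|i f _ IH]; first exact: (ccontinuous_at_cst 0).
exact: ccontinuous_atD.
Qed.

Variables (Xi : set Rn) (e : 'I_m -> Rn -> C).
Hypotheses (oXi : open Xi) (Xi0 : Xi !=set0) (cXi : connected Xi).
Let kernel x y := \sum_l e l x * (e l y)^*.
Hypothesis e_continuous : forall l x, Xi x -> ccontinuous_at (e l) x.
Hypothesis kernel_shift : forall x y h, Xi x -> Xi y -> Xi (x + h) -> Xi (y + h) ->
  kernel (x + h) (y + h) = kernel x y.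
Hypothesis e_free : forall a : 'I_m -> C,
  (forall x, Xi x -> \sum_l a l * e l x = 0) -> forall l, a l = 0.

Let v x : 'rV[C]_m := \row_l e l x.

Let kernelE p q (y : 'I_p -> Rn) (z : 'I_q -> Rn) :
  (\matrix_i v (y i)) *m adj (\matrix_i v (z i)) = \matrix_(i, j) kernel (y i) (z j).
Proof.
apply/matrixP => i j; rewrite !mxE /kernel; apply: eq_bigr => l _.
by rewrite !mxE.
Qed.

Let kernel_mx_shift p q (y : 'I_p -> Rn) (z : 'I_q -> Rn) h :
  (forall i, Xi (y i)) -> (forall i, Xi (z i)) ->
  (forall i, Xi (y i + h)) -> (forall i, Xi (z i + h)) ->
  (\matrix_i v (y i + h)) *m adj (\matrix_i v (z i + h)) =
  (\matrix_i v (y i)) *m adj (\matrix_i v (z i)).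
Proof.
move=> Yy Yz Yyh Yzh; rewrite (kernelE (fun i => y i + h) (fun i => z i + h)) kernelE.
by apply/matrixP => i j; rewrite !mxE kernel_shift.
Qed.

(** Gram matrices determine linear relations, and the kernel is the Gram matrix
    of the vectors [v x]: relations between them survive a translation. *)
Let relation_shift p (y : 'I_p -> Rn) x h (w : 'rV[C]_p) :
  (forall i, Xi (y i)) -> Xi x -> (forall i, Xi (y i + h)) -> Xi (x + h) ->
  v x = w *m \matrix_i v (y i) -> v (x + h) = w *m \matrix_i v (y i + h).
Proof.
move=> Yy Yx Yyh Yxh vxw.
have vE z : v z = \matrix_(i < 1) v z by apply/rowP => l; rewrite !mxE.
pose E := \matrix_i v (y i); pose Eh := \matrix_i v (y i + h).
pose X : 'M[C]_(1, m) := \matrix_(i < 1) v x.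
pose Xh : 'M[C]_(1, m) := \matrix_(i < 1) v (x + h).
have XE : Xh *m adj Eh = X *m adj E by exact: (@kernel_mx_shift 1 p (fun=> x) y h).
have EX : Eh *m adj Xh = E *m adj X by exact: (@kernel_mx_shift p 1 y (fun=> x) h).
have EE : Eh *m adj Eh = E *m adj E by exact: kernel_mx_shift.
have XX : Xh *m adj Xh = X *m adj X by exact: (@kernel_mx_shift 1 1 (fun=> x) (fun=> x) h).
have X0 : X = w *m E by rewrite /X -vE.
apply/eqP; rewrite -subr_eq0 (vE (x + h)) -/Xh -/Eh; apply/eqP/mul_adj_eq0.
have T2 : w *m Eh *m adj Xh = X *m adj X by rewrite -mulmxA EX mulmxA -X0.
have T3 : Xh *m (adj Eh *m adj w) = X *m adj X.
  by rewrite mulmxA XE -mulmxA -adjM -X0.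
have T4 : w *m Eh *m (adj Eh *m adj w) = X *m adj X.
  by rewrite -mulmxA (mulmxA Eh) EE -(mulmxA E) mulmxA -adjM -X0.
by rewrite adjB mulmxBl !mulmxBr adjM XX T2 T3 T4 !subrr.
Qed.

(** Small translations act on the vectors [v x] by commuting unitary matrices
    [U h]. In a common eigenbasis each component of [v] is a plane wave up to a
    factor [W] which is locally constant, at a scale [rho] that does not depend
    on the point, and connectedness makes it constant. *)
Theorem translation_invariant_kernel :
  exists (xi : 'I_m -> Rn) (w : 'I_m -> C), forall x y, Xi x -> Xi y ->
    kernel x y = \sum_k (w k * (w k)^*) * plane_wave (xi k) (x - y).
Proof.
have [p [y [Yy yspan]]] := finite_row_span Xi v.
pose E h : 'M[C]_(p, m) := \matrix_i v (y i + h).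
have E0 : E 0 = \matrix_i v (y i) by apply/matrixP => i l; rewrite !mxE addr0.
have Efull : row_full (E 0).
  rewrite -sub1mx; apply/negPn/negP; rewrite submxE => /eqP co0.
  apply: co0; rewrite mul1mx; apply/matrixP => l j; rewrite [RHS]mxE.
  apply: (e_free (a := fun l => cokermx (E 0) l j)) => x Yx.
  have : v x *m cokermx (E 0) = 0 by apply/eqP; rewrite -submxE E0; exact: yspan.
  move: (cokermx _) => B /matrixP/(_ 0 j) vB.
  transitivity ((v x *m B) 0 j); last by rewrite vB mxE.
  by rewrite mxE; apply: eq_bigr => k _; rewrite [v x 0 k]mxE mulrC.
(* [v x *m G] gives coordinates of [v x] in the vectors [v (y i)], so [U h]
   replaces these vectors by their translates. *)
pose G := pinvmx (E 0).
have GE : G *m E 0 = 1%:M by exact: mulVpmx.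
have [r r0 Yr] : exists2 r : R, 0 < r & forall i h, `|h| < r -> Xi (y i + h).
  have /choice[s sP] : forall i, exists s : R, 0 < s /\ ball (y i) s `<=` Xi.
    move=> i; have : nbhs (y i) Xi by exact: open_nbhs_nbhs.
    by move=> /nbhs_ballP[s /= s0 sX]; exists s.
  exists (\big[Order.min/1]_i s i) => [|i h].
    by apply/bigmin_gtP; split => // i _; have [] := sP i.
  move=> /bigmin_gtP[_ /(_ i isT) hs]; have [_] := sP i; apply.
  by rewrite -ball_normE /= opprD addrA subrr add0r normrN.
pose U h := G *m E h.
have vU x h : `|h| < r -> Xi x -> Xi (x + h) -> v (x + h) = v x *m U h.
  move=> hr Yx Yxh; rewrite /U mulmxA; apply: relation_shift => // [i|].
    exact: Yr.
  by rewrite -E0 -mulmxA GE mulmx1.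
have UU h : `|h| < r -> U h *m adj (U h) = 1%:M.
  move=> hr; have Yyh i : Xi (y i + h) by exact: Yr.
  rewrite /U adjM mulmxA -(mulmxA G) (kernel_mx_shift (h := h)) // -E0.
  by rewrite mulmxA -mulmxA -adjM GE trmx1 map_mx1 mulmx1.
have r2 : r / 2 < r by rewrite ltr_pdivrMr// ltr_pMr// ltr1n.
have UD h k : `|h| < r -> `|k| < r -> `|h + k| < r -> U (h + k) = U h *m U k.
  move=> hr kr hkr; rewrite {1 2}/U -mulmxA; congr (G *m _).
  apply/row_matrixP => i; rewrite row_mul /E !rowK addrA (vU (y i + h))// -?addrA; exact: Yr.
(* Half the radius, so that the sum of two small translations stays in range. *)
pose rho := r / 2.
have rho0 : 0 < rho by exact: divr_gt0.
have rho_r (h : Rn) : `|h| < rho -> `|h| < r by move=> h1; exact: lt_trans r2.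
have rhoD (h k : Rn) : `|h| < rho -> `|k| < rho -> `|h + k| < r.
  move=> h1 k1; rewrite (le_lt_trans (ler_normD _ _))// (splitr r) ltrD//.
have U0 : U 0 = 1%:M by rewrite /U GE.
have UN h : `|h| < rho -> U (- h) = adj (U h).
  move=> h1; have h1' : `|- h| < rho by rewrite normrN.
  have := UD h (- h) (rho_r _ h1) (rho_r _ h1').
  rewrite subrr normr0 => /(_ r0); rewrite U0 => h2.
  rewrite -[LHS]mul1mx; have /mulmx1C <- := UU h (rho_r _ h1).
  by rewrite -mulmxA -h2 mulmx1.
have [S SS Sdiag] := @commuting_adjoint_diag C m Rn (fun h => `|h| < rho) U
  ltac:(by move=> s t s1 t1; rewrite -!UD ?rhoD ?rho_r// addrC)
  ltac:(by move=> t t1; exists (- t); rewrite ?normrN// UN).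
have SS' : adj S *m S = 1%:M by exact: mulmx1C.
have SM A B : S *m A *m adj S *m (S *m B *m adj S) = S *m (A *m B) *m adj S.
  by rewrite !mulmxA -(mulmxA _ (adj S) S) SS' mulmx1.
pose D h := S *m U h *m adj S.
have DD h k : `|h| < rho -> `|k| < rho -> `|h + k| < rho -> D (h + k) = D h *m D k.
  by move=> h1 k1 hk1; rewrite /D UD ?rho_r// SM.
have D1 h : `|h| < rho -> D h *m adj (D h) = 1%:M.
  move=> h1; rewrite /D adjM adjK adjM [S *m (_ *m _)]mulmxA SM.
  by rewrite UU ?rho_r// mulmx1.
have diagM (A B : 'M[C]_m) k : is_diag_mx A -> (A *m B) k k = A k k * B k k.
  move=> /is_diag_mxP dA; rewrite mxE (bigD1 k)//= big1 ?addr0// => j jk.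
  by rewrite dA ?mul0r// eq_sym.
have /choice[xi xiP] : forall k, exists xi, forall h, `|h| < rho -> D h k k = plane_wave xi h.
  move=> k; have cD : ccontinuous_at (fun h => D h k k) 0.
    rewrite (_ : (fun h => _) = fun h => \sum_i (\sum_j (S *m G) k j * e i (y j + h)) * adj S i k).
      apply: ccontinuous_at_sum => i; apply: ccontinuous_atM; last exact: ccontinuous_at_cst.
      apply: ccontinuous_at_sum => j; apply: ccontinuous_atM; first exact: ccontinuous_at_cst.
      have cy : {for (0 : Rn), continuous (fun h => y j + h)}.
        apply: (@continuousD _ _ _ (cst (y j)) idfun); first exact: cst_continuous.
        exact: cvg_id.
      have [|c1 c2] := @e_continuous i (y j + 0); first by rewrite addr0.
      split.
        exact: (@continuous_comp _ _ _ (fun h : Rn => y j + h) (fun t => Re (e i t)) _ cy c1).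
      exact: (@continuous_comp _ _ _ (fun h : Rn => y j + h) (fun t => Im (e i t)) _ cy c2).
    apply/funext => h; rewrite /D /U mulmxA mxE; apply: eq_bigr => i _.
    congr (_ * _); rewrite mxE; apply: eq_bigr => j _; by rewrite !mxE.
  apply: local_character => //; last 2 first.
  - by case: cD.
  - by case: cD.
  - by move=> s t s1 t1 st1; rewrite DD// diagM//; exact: Sdiag.
  - move=> t t1; have /matrixP/(_ k k) := D1 t t1.
    rewrite diagM; last exact: Sdiag.
    by rewrite !mxE eqxx.
pose W k x := (v x *m adj S) 0 k * (plane_wave (xi k) x)^*.
have Wshift k x h : `|h| < rho -> Xi x -> Xi (x + h) -> W k (x + h) = W k x.
  move=> h1 Yx Yxh; rewrite /W (vU x h (rho_r _ h1) Yx Yxh).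
  have -> : v x *m U h *m adj S = v x *m adj S *m D h.
    by rewrite /D !mulmxA -(mulmxA _ (adj S) S) SS' mulmx1.
  have /is_diag_mxP dD := Sdiag h h1.
  rewrite [X in X * _ = _]mxE (bigD1 k)//= big1 ?addr0 => [|j jk]; last by rewrite dD ?mulr0.
  by rewrite xiP// plane_waveD rmorphM mulrACA [X in _ * X](expiK _) mulr1.
have [x0 Yx0] := Xi0.
have Wcst k x : Xi x -> W k x = W k x0.
  pose B := [set x | Xi x /\ W k x = W k x0].
  suff -> : Xi = B by move=> [].
  (* [B] and its complement in [Xi] are both unions of balls of radius [rho]
     intersected with [Xi]. *)
  symmetry; apply: cXi; first by exists x0.
    exists (\bigcup_(b in B) ball b rho).
      by apply: bigcup_open => b _; exact: ball_open.
    apply/seteqP; split => [z [Yz Wz]|z [Yz [b [Yb Wb] bz]]].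
      by split => //; exists z => //; exact: ballxx.
    split => //; rewrite -Wb -[z](addrNK b) addrC; apply: Wshift => //.
      by rewrite distrC; move: bz; rewrite -ball_normE.
    by rewrite addrC addrNK.
  exists (~` \bigcup_(b in Xi `\` B) ball b rho).
    apply: open_closedC; apply: bigcup_open => b _; exact: ball_open.
  apply/seteqP; split => [z [Yz Wz]|z [Yz nz]].
    split => // -[b [Yb nBb] bz]; apply: nBb; split => //.
    rewrite -Wz -[b](addrNK z) addrC; apply: Wshift => //.
      by move: bz; rewrite -ball_normE.
    by rewrite addrC addrNK.
  apply: contrapT => nBz; apply: nz; exists z; first by split.
  exact: ballxx.
exists xi, (W^~ x0) => x z Yx Yz.
have vW t k : Xi t -> (v t *m adj S) 0 k = W k x0 * plane_wave (xi k) t.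
  move=> Yt; rewrite -(Wcst k t Yt) /W -mulrA [X in _ * X]mulrC.
  by rewrite [X in _ * X](expiK _) mulr1.
transitivity ((v x *m adj S *m adj (v z *m adj S)) 0 0).
  rewrite adjM adjK mulmxA -(mulmxA _ (adj S) S) SS' mulmx1 mxE.
  by apply: eq_bigr => l _; rewrite !mxE.
rewrite mxE; apply: eq_bigr => k _.
rewrite [X in _ * X](_ : _ = ((v z *m adj S) 0 k)^*); last by rewrite !mxE.
by rewrite !vW// rmorphM plane_waveB mulrACA.
Qed.

End translation_invariant_kernel.

(** * Positive semidefinite forms and dimension *)

Section psd_form.
Variables (R : realType) (X : Type).
Local Notation C := R[i].
Local Notation Re := (@complex.Re R).
Local Notation Im := (@complex.Im R).
Implicit Types g h : X -> C.
Variables (T : (X -> C) -> Prop) (B : (X -> C) -> (X -> C) -> C).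
Hypothesis T0 : T (fun=> 0).
Hypothesis TL : forall c g h, T g -> T h -> T (fun x => c * g x + h x).
Hypothesis BLl : forall c g h k, T g -> T h -> T k ->
  B (fun x => c * g x + h x) k = c * B g k + B h k.
Hypothesis BLr : forall c g h k, T g -> T h -> T k ->
  B k (fun x => c * g x + h x) = c^* * B k g + B k h.
Hypothesis B_ge0 : forall g, T g -> 0 <= B g g.

Lemma psd_form0l g : T g -> B (fun=> 0) g = 0.
Proof.
move=> Tg; have E := BLl 1 T0 T0 Tg.
have Z : (fun x : X => 1 * 0 + 0) = (fun=> 0) :> (X -> C).
  by apply/funext => x; rewrite mulr0 addr0.
rewrite [X in B X g = _]Z mul1r in E.
by move/eqP: E; rewrite -subr_eq0 opprD addrA subrr add0r oppr_eq0 => /eqP.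
Qed.

Lemma psd_formE c g h : T g -> T h ->
  B (fun x => c * g x + h x) (fun x => c * g x + h x) =
  c * c^* * B g g + c * B g h + c^* * B h g + B h h.
Proof.
by move=> Tg Th; rewrite BLl ?BLr//; try exact: TL; ring.
Qed.

Lemma ge0_im (z : C) : 0 <= z -> Im z = 0.
Proof. by rewrite lecE => /andP[/eqP]. Qed.

(** Polarization: expanding the form at [g + h] and at [i g + h] shows that the
    two cross terms have opposite imaginary parts and equal real parts. *)
Lemma psd_form_herm g h : T g -> T h -> B g h = (B h g)^*.
Proof.
move=> Tg Th.
have gg := ge0_im (B_ge0 Tg); have hh := ge0_im (B_ge0 Th).
have := ge0_im (B_ge0 (TL 1 Tg Th)); have := ge0_im (B_ge0 (TL 'i%C Tg Th)).
rewrite !psd_formE// !(ImD, ImM, ReM, Re_conj, Im_conj, ReD) gg hh /= => h1 h2.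
by apply: complex_ext; rewrite ?Re_conj ?Im_conj; lra.
Qed.

(** The degenerate case of the Cauchy-Schwarz inequality: along the line
    [h - t conj(b) g], with [b] the value of the form at [(g, h)], the form is an
    affine function of [t] of slope [- 2 |b|^2], yet nonnegative. *)
Lemma psd_form_kernel g h : T g -> T h -> B g g = 0 -> B g h = 0.
Proof.
move=> Tg Th gg0; set b := B g h.
have hb : B h g = b^* by rewrite psd_form_herm.
pose s : R := Re b ^+ 2 + Im b ^+ 2; pose H := Re (B h h).
have s0 : 0 <= s by rewrite addr_ge0 ?sqr_ge0.
have key t : 0 <= - t * s *+ 2 + H.
  have := B_ge0 (TL ((- t)%:C * b^*) Tg Th).
  rewrite psd_formE// gg0 hb -/b lecE => /andP[_].
  rewrite !(ReD, ReM, Re_conj, Im_conj, ImM) /= -/H /s !expr2; lra.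
have H0 : 0 <= H by have := key 0; rewrite oppr0 mul0r mul0rn add0r.
have [s_gt0|] := ltP 0 s; last first.
  move=> s_le0; have /eqP : s = 0 by apply/eqP; rewrite eq_le s_le0.
  rewrite /s paddr_eq0 ?sqr_ge0// !sqrf_eq0 => /andP[/eqP rb /eqP jb].
  exact: complex_ext.
exfalso; have := key ((H + 1) / s); rewrite mulNr -mulrA mulVf ?gt_eqF// mulr1 => ?; clear gg0 hb; lra.
Qed.

Lemma psd_form_sum n (c : 'I_n -> C) (g : 'I_n -> X -> C) : (forall l, T (g l)) ->
  T (fun x => \sum_l c l * g l x) /\
  forall h, T h -> B (fun x => \sum_l c l * g l x) h = \sum_l c l * B (g l) h.
Proof.
elim: n c g => [|n IH] c g Tg.
  have -> : (fun x => \sum_(l < 0) c l * g l x) = fun=> 0.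
    by apply/funext => x; rewrite big_ord0.
  by split=> [|h Th]; rewrite ?big_ord0 ?psd_form0l//.
have [T1 B1] := IH (fun l => c (lift ord0 l)) (fun l => g (lift ord0 l)) (fun l => Tg _).
have -> : (fun x => \sum_l c l * g l x) = fun x => c ord0 * g ord0 x +
   \sum_l c (lift ord0 l) * g (lift ord0 l) x.
  by apply/funext => x; rewrite big_ord_recl.
split=> [|h Th]; first exact: TL.
by rewrite BLl// B1// big_ord_recl.
Qed.

(** A maximal orthonormal family exists when their sizes are bounded; the
    component of [g] orthogonal to it must be isotropic, hence in the kernel of
    the form. *)
Lemma psd_form_basis K :
  (forall n (g : 'I_n -> X -> C), (forall l, T (g l)) ->
     (forall k l, B (g k) (g l) = (k == l)%:R) -> (n <= K)%N) ->
  exists n (g : 'I_n -> X -> C), [/\ forall l, T (g l),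
     forall k l, B (g k) (g l) = (k == l)%:R &
     forall f h, T f -> T h -> B f h = \sum_l B f (g l) * B (g l) h].
Proof.
move=> bK.
pose Q n := `[< exists g : 'I_n -> X -> C, (forall l, T (g l)) /\
  forall k l, B (g k) (g l) = (k == l)%:R >].
have Q0 : exists n, Q n.
  have g0 : 'I_0 -> X -> C by case.
  by exists 0%N; apply/asboolP; exists g0; split; case.
have QK n : Q n -> (n <= K)%N by move=> /asboolP[g [Tg gg]]; exact: bK gg.
case: (ex_maxnP Q0 QK) => n /asboolP[g [Tg gg]] nmax.
exists n, g; split => // f h Tf Th.
pose P := fun x => \sum_l (- B f (g l)) * g l x.
have [TP BP] := psd_form_sum (fun l => - B f (g l)) Tg.
rewrite -/P in TP BP.
pose f' := fun x => 1 * f x + P x.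
have Tf' : T f' by exact: TL.
have Bf'g l : B f' (g l) = 0.
  rewrite /f' BLl// mul1r BP// (bigD1 l)//= gg eqxx mulr1 big1 ?addr0 ?subrr// => k kl.
  by rewrite gg (negPf kl) mulr0.
have [ff0|ff0] := eqVneq (B f' f') 0.
  have := psd_form_kernel Tf' Th ff0; rewrite /f' BLl// mul1r BP// => /eqP.
  rewrite addr_eq0 => /eqP ->; rewrite -sumrN; apply: eq_bigr => l _.
  by rewrite mulNr opprK.
exfalso.
(* Normalizing [f'] would extend the family. *)
pose r := Re (B f' f').
have rE : B f' f' = r%:C.
  by apply: complex_ext => //=; rewrite ge0_im// B_ge0.
have r0 : 0 < r.
  rewrite lt_neqAle; have := B_ge0 Tf'; rewrite rE ler0c => ->; rewrite andbT eq_sym.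
  by apply: contra ff0 => /eqP r0; rewrite rE r0.
pose s : C := (Num.sqrt r)^-1%:C.
pose f1 := fun x => s * f' x + 0.
have Tf1 : T f1 by exact: TL.
have B1l k : T k -> B f1 k = s * B f' k.
  by move=> Tk; rewrite /f1 (BLl _ Tf' T0 Tk) psd_form0l// addr0.
have sc : s^* = s by apply: complex_ext; rewrite ?Re_conj ?Im_conj//= oppr0.
have B11 : B f1 f1 = 1.
  have B0 k : T k -> B k (fun=> 0) = 0.
    by move=> Tk; rewrite psd_form_herm// psd_form0l// conjC0.
  rewrite B1l// /f1 (BLr _ Tf' T0 Tf') B0// addr0 sc rE.
  rewrite -!rmorphM /= mulrA -invfM -expr2 sqr_sqrtr ?ltW// mulVf ?gt_eqF//.
pose g' (i : 'I_n.+1) := oapp g f1 (unlift ord0 i).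
suff : (n.+1 <= n)%N by rewrite ltnn.
apply: nmax; apply/asboolP; exists g'; split => [i|i j].
  by rewrite /g'; case: unliftP => [l _|_] //=; exact: Tg.
rewrite /g'; case: (unliftP ord0 i) => [k ->|->]; case: (unliftP ord0 j) => [l ->|->] /=.
- by rewrite gg (inj_eq lift_inj).
- by rewrite psd_form_herm// B1l// Bf'g mulr0 conjC0.
- by rewrite B1l// Bf'g mulr0.
- by rewrite B11.
Qed.

End psd_form.

Section dimension.
Variables (R : realType) (n : nat).
Local Notation C := R[i].
Local Notation Rn := 'rV[R]_n.
Local Notation mu := (lebesgue_rV R n).

Lemma has_dim_free_le (D : set Rn) (V : set (Rn -> C)) K p (h : 'I_p -> Rn -> C) :
  has_dim D V K -> (forall i, V (h i)) ->
  (forall a : 'I_p -> C, (fun x => \sum_i a i * h i x) = (fun=> 0) %[ae mu in D] ->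
     forall i, a i = 0) ->
  (p <= K)%N.
Proof.
move=> [e [_ _ espan]] Vh hfree.
have /choice[a aP] : forall i, exists a : 'I_K -> C,
    h i = (fun x => \sum_k a k * e k x) %[ae mu in D].
  by move=> i; exact: espan.
pose M : 'M[C]_(p, K) := \matrix_(i, k) a i k.
rewrite leqNgt; apply/negP => Kp.
have : kermx M != 0.
  by rewrite kermx_eq0 /row_free neq_ltn (leq_ltn_trans (rank_leq_col _) Kp).
move=> /rowV0Pn[v /sub_kermxP vM v0].
have : (fun x => \sum_i v 0 i * h i x) = (fun=> 0) %[ae mu in D].
  have aeh : \forall x \ae mu, forall i, D x -> h i x = \sum_k a i k * e k x.
    by apply: filter_forall => i; exact: aP.
  apply: filterS aeh => x hx Dx.
  transitivity (\sum_k (v *m M) 0 k * e k x).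
    under eq_bigr do rewrite hx// mulr_sumr.
    rewrite exchange_big; apply: eq_bigr => k _ /=.
    rewrite mxE mulr_suml; apply: eq_bigr => i _.
    by rewrite [M i k]mxE mulrA.
  by rewrite vM big1// => k _; rewrite mxE mul0r.
move=> /hfree vi0; move/negP: v0; apply; apply/eqP/rowP => i.
by rewrite vi0 mxE.
Qed.

End dimension.

(** * The truncated convolution operator *)

Section truncated_convolution_operator.
Variables (R : realType) (n : nat).
Local Notation C := R[i].
Local Notation Rn := 'rV[R]_n.
Local Notation Re := (@complex.Re R).
Local Notation Im := (@complex.Im R).
Local Notation mu := (lebesgue_rV R n).

Lemma cae_eq0_continuous (U : set Rn) (h : Rn -> C) : open U ->
  (forall x, U x -> ccontinuous_at h x) ->
  (\forall x \ae mu, U x -> h x = 0) -> forall x, U x -> h x = 0.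
Proof.
move=> oU ch h0 x Ux; apply: complex_ext.
  apply: (ae_eq0_continuous oU (h := fun x => Re (h x))) => // [y /ch[]//|].
  by apply: filterS h0 => y /[apply] ->.
apply: (ae_eq0_continuous oU (h := fun x => Im (h x))) => // [y /ch[]//|].
by apply: filterS h0 => y /[apply] ->.
Qed.

Lemma ccontinuous_cmeasurable (U : set Rn) (h : Rn -> C) : open U ->
  (forall x, U x -> ccontinuous_at h x) -> cmeasurable U h.
Proof.
by move=> oU ch; split; apply: measurable_continuous_rV => // x /ch[].
Qed.

Lemma plane_wave_ccontinuous xi x : ccontinuous_at (@plane_wave R n xi) x.
Proof. by have [c1 c2] := plane_wave_continuous xi; split; [exact: c1|exact: c2]. Qed.

Variables (Xi : set Rn).
Hypotheses (oXi : open Xi) (bXi : bounded_set Xi).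
Let Omega : set Rn := [set x - y | x in Xi & y in Xi].

Lemma open_difference : open Omega.
Proof.
rewrite openE => _ [x Xx [y Xy <-]].
have : nbhs x Xi by exact: open_nbhs_nbhs.
move=> /nbhs_ballP[e /= e0 eX]; apply/nbhs_ballP; exists e => //= z.
rewrite -ball_normE /= => xyz; exists (z + y); last by exists y; rewrite // addrK.
apply: eX; rewrite -ball_normE /= (_ : x - (z + y) = x - y - z)//.
by rewrite opprD addrA addrAC.
Qed.

Lemma bounded_difference : bounded_set Omega.
Proof.
have [M [_ bM]] := bXi; have {}bM := bM (M + 1) ltac:(lra).
exists (M + 1 + (M + 1)); split; first exact: num_real.
move=> N MN _ [x Xx [y Xy <-]]; apply: le_trans (ler_normB _ _) _.
by apply: le_trans (ltW MN); apply: lerD; exact: bM.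
Qed.

Let mXi : measurable Xi. Proof. exact: open_measurable_rV. Qed.
Let mOmega : measurable Omega.
Proof. by apply: open_measurable_rV; exact: open_difference. Qed.
Let Xi_lty : (mu Xi < +oo)%E. Proof. exact: bounded_rV_lty. Qed.
Let Omega_lty : (mu Omega < +oo)%E.
Proof. by apply: bounded_rV_lty; rewrite //; exact: bounded_difference. Qed.

Let Xi_sub x : Xi x -> Xi `<=` (fun v => x - v) @^-1` Omega.
Proof. by move=> Xx y Xy; exists x => //; exists y. Qed.

Let measurable_test_reflect x g : test_fun Xi g ->
  measurable_fun Omega (fun z : Rn => g (x - z)).
Proof.
move=> tg; have mg : measurable_fun setT g by exact: test_fun_measurable tg.
have mxg : measurable_fun setT (fun z : Rn => g (x - z)).
  have := measurable_fun_reflect (a := x) measurableT mg.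
  by rewrite preimage_setT.
exact: measurable_funS mxg.
Qed.

Definition rconv (phi g : Rn -> R) x := \int[mu]_(z in Omega) (phi z * g (x - z)).

Let integrable_test_conv (phi g : Rn -> R) x : mu.-integrable Omega (EFin \o phi) ->
  test_fun Xi g -> mu.-integrable Omega (EFin \o (fun z => phi z * g (x - z))).
Proof.
move=> iphi tg; have [_ [M gM] _] := tg.
have M0 : 0 <= M by exact: le_trans (normr_ge0 _) (gM 0).
have mphi : measurable_fun Omega phi by apply/measurable_EFinP; exact: measurable_int iphi.
have := integrableZl mOmega M (integrable_abse iphi); apply: le_integrable => //.
  apply/measurable_EFinP; apply: measurable_funM => //.
  exact: measurable_test_reflect tg.
move=> z _ /=; rewrite lee_fin !normrM normr_id mulrC (ger0_norm M0).
by rewrite ler_wpM2r.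
Qed.

Lemma rconv_lipschitz phi g : mu.-integrable Omega (EFin \o phi) -> test_fun Xi g ->
  exists L, forall x y, `|rconv phi g x - rconv phi g y| <= L * `|x - y|.
Proof.
move=> iphi tg; have [[L gL] _ _] := tg.
exists (\int[mu]_(z in Omega) (`|L| * `|phi z|)) => x y.
have ia : mu.-integrable Omega (EFin \o (fun z => `|L| * `|phi z|)).
  have := integrableZl mOmega `|L| (integrable_abse iphi).
  by apply: eq_integrable.
rewrite -RintegralB//; try exact: integrable_test_conv.
have ib : mu.-integrable Omega (EFin \o (fun z => phi z * g (x - z) - phi z * g (y - z))).
  have := integrableB mOmega (integrable_test_conv x iphi tg) (integrable_test_conv y iphi tg).
  exact: eq_integrable.
rewrite mulrC -RintegralZl//; apply: le_trans (le_normr_Rintegral mOmega ib) _.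
apply: le_Rintegral => //.
- by have := integrable_abse ib; exact: eq_integrable.
- by have := integrableZl mOmega `|x - y| ia; apply: eq_integrable.
move=> z _; rewrite -mulrBr normrM mulrA mulrC ler_wpM2r//.
apply: le_trans (gL _ _) _.
by rewrite opprB addrA subrK mulrC ler_wpM2l// ler_norm.
Qed.

Lemma rconv_bounded phi g : mu.-integrable Omega (EFin \o phi) -> test_fun Xi g ->
  exists M, forall x, `|rconv phi g x| <= M.
Proof.
move=> iphi tg; have [_ [M gM] _] := tg.
have M0 : 0 <= M by exact: le_trans (normr_ge0 _) (gM 0).
exists (\int[mu]_(z in Omega) (M * `|phi z|)) => x.
apply: le_trans (le_normr_Rintegral _ _) _ => //; first exact: integrable_test_conv.
apply: le_Rintegral => //.
- have := integrable_abse (integrable_test_conv x iphi tg).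
  exact: eq_integrable.
- by have := integrableZl mOmega M (integrable_abse iphi); apply: eq_integrable.
by move=> z _; rewrite normrM mulrC ler_wpM2r.
Qed.

(** Moving the variable into the test function makes the domain independent of
    [x]; this is where regularity comes from. *)
Lemma rconvE (phi g : Rn -> R) (x : Rn) : measurable_fun Omega phi -> test_fun Xi g -> Xi x ->
  \int[mu]_(y in Xi) (phi (x - y) * g y) = rconv phi g x.
Proof.
move=> mphi tg Xx; have [_ _ g0] := tg.
have mF : measurable_fun Omega (fun z => (phi z * g (x - z))%:E).
  apply/measurable_EFinP; apply: measurable_funM => //.
  exact: measurable_test_reflect tg.
rewrite /rconv /Rintegral -(integral_reflect x mOmega mF); congr fine.
rewrite -[in LHS](setIidr (Xi_sub Xx)) integral_mkcondr.
apply: eq_integral => y _; rewrite patchE subKr.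
case: ifPn => //; rewrite notin_setE => nXy.
by rewrite g0// mulr0.
Qed.

Let integrable_section (phi g : Rn -> R) (x : Rn) : mu.-integrable Omega (EFin \o phi) ->
  test_fun Xi g -> Xi x -> mu.-integrable Xi (EFin \o (fun y => phi (x - y) * g y)).
Proof.
move=> iphi tg Xx.
have := integrable_reflect x mOmega (integrable_test_conv x iphi tg).
move=> /(integrableS (measurable_preimage_reflect x mOmega) mXi (Xi_sub Xx)).
by apply: eq_integrable => // y _ /=; rewrite subKr.
Qed.

Variable f : Rn -> C.
Hypothesis f_L2 : L2 Omega f.
Local Notation A := (trunc_conv f Xi).

Let if_ : cintegrable Omega f. Proof. exact: L2_cintegrable. Qed.

Lemma L2_section x : Xi x -> L2 Xi (fun y => f (x - y)).
Proof.
move=> Xx; have [rf jf foo] := f_L2.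
have mP : measurable ((fun v => x - v) @^-1` Omega) by exact: measurable_preimage_reflect.
have mr : measurable_fun ((fun v => x - v) @^-1` Omega) (fun y => Re (f (x - y))).
  exact: (measurable_fun_reflect (a := x) mOmega rf).
have mj : measurable_fun ((fun v => x - v) @^-1` Omega) (fun y => Im (f (x - y))).
  exact: (measurable_fun_reflect (a := x) mOmega jf).
split.
- by apply: measurable_funS mr => //; exact: Xi_sub.
- by apply: measurable_funS mj => //; exact: Xi_sub.
pose F z := (ComplexField.Normc.normc (f z) ^+ 2)%:E.
have mF : measurable_fun Omega F.
  rewrite /F; under eq_fun do rewrite normc_sqr.
  by apply/measurable_EFinP/measurable_funD; exact: measurable_funX.
apply: le_lt_trans foo; rewrite -(ge0_integral_reflect x mOmega mF); last first.
  by move=> z _; rewrite lee_fin sqr_ge0.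
apply: ge0_subset_integral => //; first exact: (measurable_fun_reflect (a := x) mOmega mF).
  by move=> z _; rewrite lee_fin sqr_ge0.
exact: Xi_sub.
Qed.

Lemma trunc_conv_lin c g h x : L2 Xi g -> L2 Xi h -> Xi x ->
  A (fun y => c * g y + h y) x = c * A g x + A h x.
Proof.
move=> Lg Lh Xx; have Lf := L2_section Xx.
have ig := L2_mul mXi Lf Lg; have ih := L2_mul mXi Lf Lh.
rewrite /trunc_conv -cintegralZ// -cintegralD//; last exact: cintegrableZ.
by apply: eq_cintegral => y _; ring.
Qed.

Definition ctest (g : Rn -> C) :=
  test_fun Xi (fun x => Re (g x)) /\ test_fun Xi (fun x => Im (g x)).

Lemma test_fun_comb (a b : R) (g h k : Rn -> R) : test_fun Xi g -> test_fun Xi h ->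
  test_fun Xi k -> test_fun Xi (fun x => a * g x + b * h x + k x).
Proof.
move=> [[Lg gL] [Mg gM] g0] [[Lh hL] [Mh hM] h0] [[Lk kL] [Mk kM] k0]; split.
- exists (`|a| * Lg + `|b| * Lh + Lk) => x y.
  have -> : a * g x + b * h x + k x - (a * g y + b * h y + k y) =
     a * (g x - g y) + b * (h x - h y) + (k x - k y) by ring.
  apply: le_trans (ler_normD _ _) _; rewrite mulrDl lerD//.
  apply: le_trans (ler_normD _ _) _; rewrite mulrDl !normrM -!mulrA.
  by rewrite lerD// ler_wpM2l.
- exists (`|a| * Mg + `|b| * Mh + Mk) => x.
  apply: le_trans (ler_normD _ _) _; rewrite lerD//.
  by apply: le_trans (ler_normD _ _) _; rewrite !normrM lerD// ler_wpM2l.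
- by move=> x nx; rewrite g0// h0// k0// !mulr0 !addr0.
Qed.

Lemma ctest_lin c g h : ctest g -> ctest h -> ctest (fun x => c * g x + h x).
Proof.
move=> [rg jg] [rh jh]; split.
  rewrite (_ : (fun x => _) = fun x => Re c * Re (g x) + - Im c * Im (g x) + Re (h x)).
    exact: test_fun_comb.
  by apply/funext => x; rewrite ReD ReM mulNr.
rewrite (_ : (fun x => _) = fun x => Re c * Im (g x) + Im c * Re (g x) + Im (h x)).
  exact: test_fun_comb.
by apply/funext => x; rewrite ImD ImM.
Qed.

Lemma test_fun0 : test_fun Xi (fun=> 0).
Proof.
split=> //; first by exists 0 => x y; rewrite subrr normr0 mul0r.
by exists 0 => x; rewrite normr0.
Qed.

Lemma ctest0 : ctest (fun=> 0). Proof. by split; exact: test_fun0. Qed.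

Lemma ctest_real g : test_fun Xi g -> ctest (fun x => (g x)%:C).
Proof. by move=> tg; split => //; exact: test_fun0. Qed.

Lemma ctest_L2 g : ctest g -> L2 Xi g.
Proof.
move=> [rg jg]; have [_ [Mr rM] _] := rg; have [_ [Mj jM] _] := jg.
apply: (@L2_bounded _ _ _ mXi _ (Mr ^+ 2 + Mj ^+ 2)) => // [|x _].
  by split; [exact: test_fun_measurable rg|exact: test_fun_measurable jg].
by rewrite -(real_normK (num_real (Re _))) -(real_normK (num_real (Im _))) lerD//
  lerXn2r ?nnegrE// (le_trans _ (rM x), le_trans _ (jM x)).
Qed.

Lemma trunc_conv_test g x : ctest g -> Xi x ->
  A g x = (rconv (fun z => Re (f z)) (fun y => Re (g y)) x -
           rconv (fun z => Im (f z)) (fun y => Im (g y)) x) +i*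
          (rconv (fun z => Re (f z)) (fun y => Im (g y)) x +
           rconv (fun z => Im (f z)) (fun y => Re (g y)) x).
Proof.
move=> [rg jg] Xx; have [rf jf] := if_.
have [mrf mjf] := cintegrable_cmeasurable if_.
have rr := integrable_section rf rg Xx; have rj := integrable_section rf jg Xx.
have jr := integrable_section jf rg Xx; have jj := integrable_section jf jg Xx.
rewrite -!rconvE// /trunc_conv /cintegral; congr Complex.
  rewrite -RintegralB//.
  by apply: eq_Rintegral => y _; rewrite ReM.
rewrite -RintegralD//.
by apply: eq_Rintegral => y _; rewrite ImM.
Qed.

Lemma trunc_conv_continuous g x : ctest g -> Xi x -> ccontinuous_at (A g) x.
Proof.
move=> tg Xx; have [rg jg] := tg; have [rf jf] := if_.
have near_eq (F G : Rn -> R) : (forall y, Xi y -> F y = G y) -> continuous G ->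
    {for x, continuous F}.
  move=> FG cG; have xX : nbhs x Xi by exact: open_nbhs_nbhs.
  move=> W; rewrite (FG x Xx) => WG.
  have xW : nbhs x (G @^-1` W) by exact: cG.
  by apply: filterS2 xX xW => y Xy /=; rewrite FG.
have cr phi h : mu.-integrable Omega (EFin \o phi) -> test_fun Xi h ->
    continuous (rconv phi h).
  by move=> iphi th; apply: lipschitz_continuous; exact: rconv_lipschitz.
split.
  apply: near_eq; first by move=> y Xy; rewrite trunc_conv_test.
  by move=> y; apply: continuousB; exact: cr.
apply: near_eq; first by move=> y Xy; rewrite trunc_conv_test.
by move=> y; apply: continuousD; exact: cr.
Qed.

Lemma trunc_conv_L2 g : ctest g -> L2 Xi (A g).
Proof.
move=> tg; have [rg jg] := tg; have [rf jf] := if_.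
have [M1 b1] := rconv_bounded rf rg; have [M2 b2] := rconv_bounded jf jg.
have [M3 b3] := rconv_bounded rf jg; have [M4 b4] := rconv_bounded jf rg.
apply: (@L2_bounded _ _ _ mXi _ ((M1 + M2) ^+ 2 + (M3 + M4) ^+ 2)) => // [|x Xx].
  by apply: ccontinuous_cmeasurable => // x; exact: trunc_conv_continuous.
have sq (a b : R) : `|a| <= b -> a ^+ 2 <= b ^+ 2.
  by move=> ab; rewrite -(real_normK (num_real a)) lerXn2r ?nnegrE// (le_trans _ ab).
rewrite trunc_conv_test//= lerD// sq//.
  by rewrite (le_trans (ler_normB _ _))// lerD.
by rewrite (le_trans (ler_normD _ _))// lerD.
Qed.

End truncated_convolution_operator.

(** * Kernels of positive semidefinite operators of finite rank *)

Section finite_rank_kernel.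
Variables (R : realType) (n : nat).
Local Notation C := R[i].
Local Notation Rn := 'rV[R]_n.
Local Notation Re := (@complex.Re R).
Local Notation Im := (@complex.Im R).
Local Notation mu := (lebesgue_rV R n).

Variables (Xi : set Rn).
Hypotheses (oXi : open Xi) (bXi : bounded_set Xi).
Let Omega : set Rn := [set x - y | x in Xi & y in Xi].
Variable f : Rn -> C.
Hypothesis f_L2 : L2 Omega f.
Local Notation A := (trunc_conv f Xi).
Local Notation B g h := (L2_inner Xi (A g) h).
Local Notation T := (ctest Xi).

Let mXi : measurable Xi. Proof. exact: open_measurable_rV. Qed.
Let Xi_lty : (mu Xi < +oo)%E. Proof. exact: bounded_rV_lty. Qed.

Let B_integrable g h : T g -> T h -> cintegrable Xi (fun x => A g x * (h x)^*).
Proof.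
move=> Tg Th; apply: (L2_mul mXi); first exact: trunc_conv_L2.
by apply: L2_conj => //; exact: ctest_L2.
Qed.

Let BLl c g h k : T g -> T h -> T k ->
  B (fun x => c * g x + h x) k = c * B g k + B h k.
Proof.
move=> Tg Th Tk; have ig := B_integrable Tg Tk; have ih := B_integrable Th Tk.
have icg := cintegrableZ mXi c ig.
rewrite /L2_inner -cintegralZ// -cintegralD//.
apply: eq_cintegral => x Xx.
by rewrite trunc_conv_lin//; [ring|exact: ctest_L2|exact: ctest_L2].
Qed.

Let BLr c g h k : T g -> T h -> T k ->
  B k (fun x => c * g x + h x) = c^* * B k g + B k h.
Proof.
move=> Tg Th Tk; have ig := B_integrable Tk Tg; have ih := B_integrable Tk Th.
have icg := cintegrableZ mXi c^* ig.
rewrite /L2_inner -cintegralZ// -cintegralD//.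
by apply: eq_cintegral => x Xx; rewrite rmorphD rmorphM; ring.
Qed.

Hypothesis A_psd : psd Xi A.

Let B_ge0 g : T g -> 0 <= B g g.
Proof. by move=> Tg; apply: A_psd; exact: ctest_L2. Qed.

(** With an orthonormal basis of tests for the form of the operator, the range
    of the operator is spanned by continuous functions, and these give its
    kernel as a sum of rank-one terms. *)
Theorem finite_rank_kernel K : has_rank Xi Xi A K ->
  exists m (e : 'I_m -> Rn -> C),
  [/\ forall l x, Xi x -> ccontinuous_at (e l) x,
      forall a : 'I_m -> C, (forall x, Xi x -> \sum_l a l * e l x = 0) ->
        forall l, a l = 0 &
      forall x, Xi x ->
        (fun y => f (x - y)) = (fun y => \sum_l e l x * (e l y)^*) %[ae mu in Xi]].
Proof.
move=> rkA.
have free p (g : 'I_p -> Rn -> C) (a : 'I_p -> C) : (forall l, T (g l)) ->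
    (forall k l, B (g k) (g l) = (k == l)%:R) ->
    (fun x => \sum_l a l * A (g l) x) = (fun=> 0) %[ae mu in Xi] -> forall l, a l = 0.
  move=> Tg gg a0 j.
  transitivity (\sum_l a l * B (g l) (g j)).
    rewrite (bigD1 j)//= gg eqxx mulr1 big1 ?addr0// => l lj.
    by rewrite gg (negPf lj) mulr0.
  transitivity (\sum_l cintegral Xi (fun x => a l * (A (g l) x * (g j x)^*))).
    by apply: eq_bigr => l _; rewrite cintegralZ//; exact: B_integrable.
  have iab l : cintegrable Xi (fun x => a l * (A (g l) x * (g j x)^*)).
    by apply: cintegrableZ => //; exact: B_integrable.
  rewrite -cintegral_sum// -[RHS](cintegral0 mXi); apply: ae_eq_cintegral => //.
    by apply: cintegrable_cmeasurable; exact: (cintegrable_sum mXi iab).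
  apply: filterS a0 => x ax Xx; under eq_bigr do rewrite mulrA.
  by rewrite -mulr_suml ax// mul0r.
have bK p (g : 'I_p -> Rn -> C) : (forall l, T (g l)) ->
    (forall k l, B (g k) (g l) = (k == l)%:R) -> (p <= K)%N.
  move=> Tg gg; apply: (has_dim_free_le rkA (h := fun l => A (g l))).
    by move=> l; exists (g l) => //; exact: ctest_L2.
  by move=> a /free; apply.
have [m [g [Tg gg gB]]] := psd_form_basis (ctest0 Xi) (@ctest_lin R n Xi) BLl BLr B_ge0 bK.
pose e l := A (g l).
have e_cont l x : Xi x -> ccontinuous_at (e l) x.
  by move=> Xx; exact: trunc_conv_continuous.
have Le l : L2 Xi (e l) by exact: trunc_conv_L2.
exists m, e; split => // [a ae0|x Xx].
  by apply: (free _ g) => //; exact: aeW.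
have AE k z : test_fun Xi k -> Xi z ->
    A (fun y => (k y)%:C) z = \sum_l B (fun y => (k y)%:C) (g l) * e l z.
  move=> tk; set kC := fun y => _.
  have Tk : T kC by exact: ctest_real.
  pose F y := A kC y + \sum_l (- B kC (g l)) * e l y.
  suff F0 y : Xi y -> F y = 0.
    move=> Xz; apply/eqP; rewrite -subr_eq0; apply/eqP; rewrite -[RHS](F0 z Xz) /F; congr (_ + _).
    by rewrite -sumrN; apply: eq_bigr => l _; rewrite mulNr.
  have iF : cintegrable Xi F.
    apply: (cintegrableD mXi).
      by apply: (L2_cintegrable mXi) => //; exact: trunc_conv_L2.
    apply: (cintegrable_sum mXi) => l; apply: (cintegrableZ mXi).
    exact: (L2_cintegrable mXi).
  move: y; apply: (cae_eq0_continuous oXi) => [y Xy|].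
    apply: ccontinuous_atD; first exact: trunc_conv_continuous.
    apply: ccontinuous_at_sum => l; apply: ccontinuous_atM; last exact: e_cont.
    exact: ccontinuous_at_cst.
  apply: (ctest_separate oXi iF) => h th.
  pose hC := fun y => (h y)%:C; have Th : T hC by exact: ctest_real.
  have hCE y : (hC y)^* = hC y by exact: conjc_real.
  have il l : cintegrable Xi (fun y => (- B kC (g l)) * (e l y * (hC y)^*)).
    by apply: (cintegrableZ mXi); exact: B_integrable.
  transitivity (cintegral Xi (fun y => A kC y * (hC y)^* +
      \sum_l (- B kC (g l)) * (e l y * (hC y)^*))).
    apply: eq_cintegral => y _; rewrite hCE /F mulrDl mulr_suml; congr (_ + _).
    by apply: eq_bigr => l _; rewrite mulrA.
  rewrite (cintegralD mXi (B_integrable Tk Th) (cintegrable_sum mXi il)).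
  rewrite (cintegral_sum mXi il) -/(L2_inner Xi (A kC) hC) (gB kC hC)//.
  rewrite -big_split big1// => l _ /=.
  by rewrite (cintegralZ mXi)//; [rewrite mulNr subrr|exact: B_integrable].
have Lf : L2 Xi (fun y => f (x - y)) by exact: L2_section.
pose D y := f (x - y) + \sum_l (- e l x) * (e l y)^*.
have ie l : cintegrable Xi (fun y => (e l y)^*).
  by apply: (cintegrable_conj mXi); exact: (L2_cintegrable mXi).
have iD : cintegrable Xi D.
  apply: (cintegrableD mXi); first exact: (L2_cintegrable mXi).
  by apply: (cintegrable_sum mXi) => l; exact: (cintegrableZ mXi).
have D0 : D = (fun=> 0) %[ae mu in Xi].
  apply: (ctest_separate oXi iD) => k tk.
  pose kC := fun y => (k y)%:C; have Tk : T kC by exact: ctest_real.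
  have kCE y : (kC y)^* = kC y by exact: conjc_real.
  have iek l : cintegrable Xi (fun y => (e l y * (kC y)^*)^*).
    by apply: (cintegrable_conj mXi); exact: B_integrable.
  have il l : cintegrable Xi (fun y => (- e l x) * (e l y * (kC y)^*)^*).
    exact: (cintegrableZ mXi).
  transitivity (cintegral Xi (fun y => f (x - y) * kC y +
      \sum_l (- e l x) * (e l y * (kC y)^*)^*)).
    apply: eq_cintegral => y _; rewrite /D mulrDl mulr_suml; congr (_ + _).
    by apply: eq_bigr => l _; rewrite kCE rmorphM mulrA; congr (_ * _); exact/esym/kCE.
  rewrite (cintegralD mXi (L2_mul mXi Lf (ctest_L2 oXi bXi Tk)) (cintegrable_sum mXi il)).
  rewrite (cintegral_sum mXi il) -/(trunc_conv f Xi kC x) (AE k x tk Xx) -big_split big1// => l _ /=.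
  rewrite (cintegralZ mXi)// (cintegral_conj mXi); last exact: B_integrable.
  rewrite -[cintegral _ _]/(L2_inner Xi (A (g l)) kC).
  rewrite -(psd_form_herm (@ctest_lin R n Xi) BLl BLr B_ge0 Tk (Tg l)).
  by rewrite mulNr mulrC subrr.
apply: filterS D0 => y Dy Xy; apply/eqP; rewrite -subr_eq0; apply/eqP; rewrite -[RHS](Dy Xy) /D.
congr (_ + _); rewrite -sumrN.
by apply: eq_bigr => l _; rewrite mulNr.
Qed.

End finite_rank_kernel.

(** * From the kernel to plane waves *)

Section wave_expansion.
Variables (R : realType) (n : nat).
Local Notation C := R[i].
Local Notation Rn := 'rV[R]_n.
Local Notation mu := (lebesgue_rV R n).

Lemma ae_countable (T : countType) (P : T -> Rn -> Prop) :
  (forall q, \forall x \ae mu, P q x) -> \forall x \ae mu, forall q, P q x.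
Proof.
move=> aeP; pose Q k x := if unpickle k is Some q then P q x else True.
have : \forall x \ae mu, forall k, Q k x.
  apply: ae_foralln => k; rewrite /Q; case: unpickle => [q|]; first exact: aeP.
  exact: aeW.
by apply: filterS => x Qx q; have := Qx (pickle q); rewrite /Q pickleK.
Qed.

Lemma open_rational (U : set Rn) : open U -> U !=set0 ->
  exists q : 'rV[rat]_n, U (map_mx ratr q).
Proof.
move=> oU [x Ux].
have [e /= e0 eU] : exists2 e : R, 0 < e & ball x e `<=` U.
  by move: oU; rewrite openE => /(_ _ Ux) /nbhs_ballP.
have /choice[q qP] : forall i, exists q : rat, ratr q \in `]x 0 i - e, x 0 i + e[.
  move=> i; have [|q qi] := @rat_in_itvoo R (x 0 i - e) (x 0 i + e); first by lra.
  by exists q.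
exists (\row_i q i); apply: eU; split => // i j; rewrite ord1 !mxE ball_itv /=.
exact: qP.
Qed.

Variables (Xi : set Rn).
Hypotheses (oXi : open Xi) (Xi0 : Xi !=set0) (bXi : bounded_set Xi) (cXi : connected Xi).
Let Omega : set Rn := [set x - y | x in Xi & y in Xi].
Variable f : Rn -> C.
Hypothesis f_L2 : L2 Omega f.

(** Rational base points suffice: a point [x - y] of the difference set is also
    [q - (q - (x - y))] for every [q] close to [x]. *)
Lemma ae_difference (f0 : Rn -> C) :
  (forall x, Xi x -> (fun y => f (x - y)) = (fun y => f0 (x - y)) %[ae mu in Xi]) ->
  f = f0 %[ae mu in Omega].
Proof.
move=> ff0.
have : \forall z \ae mu, forall q : 'rV[rat]_n,
    Xi (map_mx ratr q) -> Xi (map_mx ratr q - z) -> f z = f0 z.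
  apply: ae_countable => q; set x : Rn := map_mx ratr q.
  have [Xx|nXx] := pselect (Xi x); last by apply: aeW.
  have := ae_reflect x (ff0 x Xx); apply: filterS => z H _.
  by move=> /H; rewrite subKr.
apply: filterS => z H [x Xx [y Xy xyz]].
have oU : open (Xi `&` (fun v => v - z) @^-1` Xi).
  apply: openI => //; apply: open_comp => // v _.
  by apply: continuousB; [exact: cvg_id|exact: cst_continuous].
have [|q [Xq Xqz]] := open_rational oU; last exact: (H q).
by exists x; split => //=; rewrite -xyz subKr.
Qed.

Theorem psd_finite_rank_waves K : psd Xi (trunc_conv f Xi) ->
  has_rank Xi Xi (trunc_conv f Xi) K ->
  exists m (xi : 'I_m -> Rn) (w : 'I_m -> C),
    f = (fun x => \sum_k (w k * (w k)^*) * plane_wave (xi k) x) %[ae mu in Omega].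
Proof.
move=> Apsd rkA.
have [m [e [e_cont e_free fe]]] := finite_rank_kernel oXi bXi f_L2 Apsd rkA.
have shift x y h : Xi x -> Xi y -> Xi (x + h) -> Xi (y + h) ->
    \sum_l e l (x + h) * (e l (y + h))^* = \sum_l e l x * (e l y)^*.
  move=> Xx Xy Xxh Xyh.
  (* Both sides equal [f (x - v)] for almost every [v] in place of [y]. *)
  pose U := Xi `&` (fun v => v + h) @^-1` Xi.
  have ch : continuous (fun v : Rn => v + h).
    by move=> v; apply: continuousD; [exact: cvg_id|exact: cst_continuous].
  have oU : open U by apply: openI => //; apply: open_comp => // v _; exact: ch.
  pose F v := \sum_l e l (x + h) * (e l (v + h))^* + \sum_l (- e l x) * (e l v)^*.
  suff F0 : F y = 0.
    apply/eqP; rewrite -subr_eq0; apply/eqP; rewrite -[RHS]F0 /F; congr (_ + _).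
    by rewrite -sumrN; apply: eq_bigr => l _; rewrite mulNr.
  have Uy : U y by split.
  move: y {Xy Xyh} Uy; apply: cae_eq0_continuous => // [v [Xv Xvh]|].
    apply: ccontinuous_atD; apply: ccontinuous_at_sum => l;
      apply: ccontinuous_atM; try exact: ccontinuous_at_cst;
      apply: ccontinuous_at_conj; last exact: e_cont.
    have [c1 c2] := e_cont l _ Xvh; split.
      exact: (@continuous_comp _ _ _ (fun v : Rn => v + h) (fun t => complex.Re (e l t)) _ (ch v) c1).
    exact: (@continuous_comp _ _ _ (fun v : Rn => v + h) (fun t => complex.Im (e l t)) _ (ch v) c2).
  have := ae_shift h (fe _ Xxh); apply: filterS2 (fe _ Xx) => v fv fvh [Xv Xvh].
  rewrite /F -(fvh Xvh); under [X in _ + X]eq_bigr do rewrite mulNr.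
  by rewrite sumrN -(fv Xv) opprD addrACA subrr addr0 subrr.
have [xi [w kE]] := translation_invariant_kernel oXi Xi0 cXi e_cont shift e_free.
exists m, xi, w; apply: ae_difference => x Xx.
by apply: filterS (fe x Xx) => y fy Xy; rewrite fy// kE.
Qed.

End wave_expansion.

Lemma merge_frequencies (R : realType) (T : eqType) m (xi : 'I_m -> T) (r : 'I_m -> R) :
  (forall k, 0 <= r k) ->
  exists p (eta : 'I_p -> T) (c : 'I_p -> R),
  [/\ injective eta, forall j, 0 < c j &
      forall F : T -> R[i], \sum_k (r k)%:C * F (xi k) = \sum_j (c j)%:C * F (eta j)].
Proof.
move=> r0; pose b t := \sum_(k | xi k == t) r k.
pose s0 := undup (codom xi); pose s := [seq t <- s0 | b t != 0].
have us : uniq s by rewrite filter_uniq// undup_uniq.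
exists (size s), (tnth (in_tuple s)), (fun j => b (tnth (in_tuple s) j)); split.
- by apply/tuple_uniqP.
- move=> j; rewrite lt_neqAle sumr_ge0 // andbT eq_sym.
  by have := mem_tnth j (in_tuple s); rewrite mem_filter => /andP[].
move=> F; rewrite -(big_tnth _ _ s xpredT (fun t => (b t)%:C * F t)) big_filter.
transitivity (\sum_(t <- s0) \sum_(k | xi k == t) (r k)%:C * F t).
  rewrite (exchange_big_dep xpredT)//=; apply: eq_bigr => k _.
  rewrite (eq_bigl (fun t => t == xi k)) => [|t]; last by rewrite eq_sym.
  by rewrite -big_filter filter_pred1_uniq ?undup_uniq ?mem_undup ?codom_f// big_seq1.
rewrite [RHS]big_mkcond; apply: eq_bigr => t _; rewrite -mulr_suml -rmorph_sum -/(b t).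
by case: ifPn => //; rewrite negbK => /eqP ->; rewrite mul0r.
Qed.

(** * Operators whose kernel is a combination of plane waves *)

Section plane_wave_operator.
Variables (R : realType) (n : nat).
Local Notation C := R[i].
Local Notation Rn := 'rV[R]_n.
Local Notation Re := (@complex.Re R).
Local Notation Im := (@complex.Im R).
Local Notation mu := (lebesgue_rV R n).

Lemma L2_lin (D : set Rn) (c : C) (f g : Rn -> C) : measurable D ->
  L2 D f -> L2 D g -> L2 D (fun x => c * f x + g x).
Proof.
move=> mD Lf Lg; have [rf jf _] := Lf; have [rg jg _] := Lg.
have mh : cmeasurable D (fun x => c * f x + g x).
  split.
    under eq_fun do rewrite ReD ReM.
    by apply: measurable_funD => //; apply: measurable_funB; apply: measurable_funM.
  under eq_fun do rewrite ImD ImM.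
  by apply: measurable_funD => //; apply: measurable_funD; apply: measurable_funM.
split; [exact: mh.1|exact: mh.2|].
have Lf' := L2_conj Lf; have Lg' := L2_conj Lg.
have [ih _] := cintegrableD mD
  (cintegrableD mD (cintegrableZ mD (c * c^*) (L2_mul mD Lf Lf'))
                   (cintegrableZ mD c (L2_mul mD Lf Lg')))
  (cintegrableD mD (cintegrableZ mD c^* (L2_mul mD Lg Lf')) (L2_mul mD Lg Lg')).
have /integrableP[_] := ih; apply: le_lt_trans.
rewrite le_eqVlt; apply/orP; left; apply/eqP; apply: eq_integral => x _ /=.
rewrite normc_sqr.
have -> : c * c^* * (f x * (f x)^*) + c * (f x * (g x)^*) +
    (c^* * (g x * (f x)^*) + g x * (g x)^*) = (c * f x + g x) * (c * f x + g x)^*.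
  by rewrite rmorphD rmorphM; ring.
rewrite [Re (_ * _)]ReM Re_conj Im_conj mulrN opprK -!expr2 ger0_norm//.
by rewrite addr_ge0 ?sqr_ge0.
Qed.

Lemma L2_sum (D : set Rn) p (a : 'I_p -> C) (g : 'I_p -> Rn -> C) : measurable D ->
  (forall k, L2 D (g k)) -> L2 D (fun x => \sum_k a k * g k x).
Proof.
move=> mD; elim: p a g => [|p IH] a g Lg.
  rewrite (_ : (fun x => _) = fun=> 0); last by apply/funext => x; rewrite big_ord0.
  split; [exact: measurable_cst|exact: measurable_cst|].
  by rewrite integral0_eq ?ltry// => x _; rewrite normc_sqr /= expr0n addr0.
rewrite (_ : (fun x => _) = fun x => a ord0 * g ord0 x +
   \sum_k a (lift ord0 k) * g (lift ord0 k) x); last first.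
  by apply/funext => x; rewrite big_ord_recl.
by apply: L2_lin => //; apply: IH.
Qed.

Variables (Xi : set Rn).
Hypotheses (oXi : open Xi) (Xi0 : Xi !=set0) (bXi : bounded_set Xi).
Let Omega : set Rn := [set x - y | x in Xi & y in Xi].
Variable f : Rn -> C.
Hypothesis f_L2 : L2 Omega f.
Variables (p : nat) (xi : 'I_p -> Rn) (c : 'I_p -> R).
Hypotheses (ixi : injective xi) (c_gt0 : forall k, 0 < c k).
Hypothesis f_waves :
  f = (fun x => \sum_k (c k)%:C * plane_wave (xi k) x) %[ae mu in Omega].

Local Notation E k := (plane_wave (xi k)).
Local Notation A := (trunc_conv f Xi).
Local Notation ip g h := (cintegral Xi (fun y => g y * (h y)^*)).

Let mXi : measurable Xi. Proof. exact: open_measurable_rV. Qed.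
Let Xi_lty : (mu Xi < +oo)%E. Proof. exact: bounded_rV_lty. Qed.

Let LE k : L2 Xi (E k).
Proof.
apply: (@L2_bounded _ _ _ mXi _ 1) => // [|x _]; first exact: plane_wave_cmeasurable.
by rewrite (unit_sqr (expiK _)).
Qed.

Let ipE g k : L2 Xi g -> cintegrable Xi (fun y => g y * (E k y)^*).
Proof. by move=> Lg; apply: (L2_mul mXi Lg); apply: L2_conj. Qed.

Let wave_operatorE g x : L2 Xi g -> Xi x ->
  A g x = \sum_k (c k)%:C * ip g (E k) * E k x.
Proof.
move=> Lg Xx; have Lf : L2 Xi (fun y => f (x - y)) by exact: L2_section.
have iw k : cintegrable Xi (fun y => ((c k)%:C * E k x) * (g y * (E k y)^*)).
  by apply: (cintegrableZ mXi); exact: ipE.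
transitivity (cintegral Xi (fun y => \sum_k ((c k)%:C * E k x) * (g y * (E k y)^*))).
  apply: ae_eq_cintegral => //.
  - by apply: cintegrable_cmeasurable; exact: (L2_mul mXi Lf Lg).
  - by apply: cintegrable_cmeasurable; exact: (cintegrable_sum mXi iw).
  have := ae_reflect x f_waves; apply: filterS => y fy Xy.
  rewrite fy; last by exists x => //; exists y.
  rewrite mulr_suml; apply: eq_bigr => k _; rewrite plane_waveB; ring.
rewrite (cintegral_sum mXi iw); apply: eq_bigr => k _.
by rewrite (cintegralZ mXi); [ring|exact: ipE].
Qed.

Theorem plane_waves_psd : psd Xi A.
Proof.
move=> g Lg.
have iw k : cintegrable Xi (fun x => ((c k)%:C * ip g (E k)) * (g x * (E k x)^*)^*).
  by apply: (cintegrableZ mXi); apply: (cintegrable_conj mXi); exact: ipE.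
have -> : L2_inner Xi (A g) g = \sum_k (c k)%:C * (ip g (E k) * (ip g (E k))^*).
  transitivity (cintegral Xi (fun x =>
      \sum_k ((c k)%:C * ip g (E k)) * (g x * (E k x)^*)^*)).
    apply: eq_cintegral => x Xx; rewrite wave_operatorE// mulr_suml.
    apply: eq_bigr => k _; rewrite rmorphM -!mulrA; congr (_ * (_ * _)).
    rewrite mulrC; congr (_ * _); exact/esym/conjCK.
  rewrite (cintegral_sum mXi iw); apply: eq_bigr => k _.
  by rewrite (cintegralZ mXi) ?(cintegral_conj mXi) ?mulrA//; [exact: ipE|
    apply: (cintegrable_conj mXi); exact: ipE].
by apply: sumr_ge0 => k _; rewrite mulr_ge0 ?mul_conjC_ge0// ler0c ltW.
Qed.

Let waves_free (a : 'I_p -> C) :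
  (fun x => \sum_k a k * E k x) = (fun=> 0) %[ae mu in Xi] -> forall k, a k = 0.
Proof.
move=> a0; apply: (plane_wave_indep ixi oXi Xi0).
apply: (cae_eq0_continuous oXi) => // x _.
apply: ccontinuous_at_sum => k; apply: ccontinuous_atM.
  exact: ccontinuous_at_cst.
exact: plane_wave_ccontinuous.
Qed.

Let gram : 'M[C]_p := \matrix_(j, k) ip (E j) (E k).

Let ip_suml (a : 'I_p -> C) k :
  ip (fun x => \sum_j a j * E j x) (E k) = \sum_j a j * gram j k.
Proof.
have ia j : cintegrable Xi (fun y => a j * (E j y * (E k y)^*)).
  by apply: (cintegrableZ mXi); exact: ipE.
transitivity (cintegral Xi (fun y => \sum_j a j * (E j y * (E k y)^*))).
  by apply: eq_cintegral => y _; rewrite mulr_suml; apply: eq_bigr => j _; rewrite mulrA.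
rewrite (cintegral_sum mXi ia); apply: eq_bigr => j _.
by rewrite (cintegralZ mXi) ?mxE//; exact: ipE.
Qed.

(** A left null vector of the Gram matrix is a combination of waves orthogonal
    to all of them, hence to itself. *)
Let gram_unit : gram \in unitmx.
Proof.
rewrite -row_free_unit -kermx_eq0; apply/rowV0P => v /sub_kermxP vG.
pose h x := \sum_j v 0 j * E j x.
have Lh : L2 Xi h by exact: L2_sum.
have hE k : ip h (E k) = 0.
  rewrite ip_suml; have /matrixP/(_ 0 k) := vG.
  by rewrite mxE [RHS]mxE.
have ih k : cintegrable Xi (fun x => (v 0 k)^* * (h x * (E k x)^*)).
  by apply: (cintegrableZ mXi); exact: ipE.
have : ip h h = 0.
  transitivity (cintegral Xi (fun x => \sum_k (v 0 k)^* * (h x * (E k x)^*))).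
    apply: eq_cintegral => x _; rewrite {2}/h rmorph_sum mulr_sumr.
    by apply: eq_bigr => k _; rewrite rmorphM; ring.
  rewrite (cintegral_sum mXi ih) big1// => k _.
  by rewrite (cintegralZ mXi) ?hE ?mulr0//; exact: ipE.
move=> /(cintegral_norm0 mXi Lh) /waves_free v0.
by apply/rowP => k; rewrite v0 mxE.
Qed.

(** The inverse of the Gram matrix provides functions [g k] dual to the waves, so
    that the wave [E k] is, up to the factor [c k], the image of [g k]. *)
Theorem plane_waves_rank : has_rank Xi Xi A p.
Proof.
pose g k x := \sum_j invmx gram k j * E j x.
have Lg k : L2 Xi (g k) by exact: L2_sum.
have gE k l : ip (g k) (E l) = (k == l)%:R.
  rewrite ip_suml; have /matrixP/(_ k l) := mulVmx gram_unit.
  by rewrite mxE [RHS]mxE.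
have Ag k x : Xi x -> A (g k) x = (c k)%:C * E k x.
  move=> Xx; rewrite wave_operatorE// (bigD1 k)//= big1 ?addr0 => [|j jk].
    by rewrite gE eqxx mulr1.
  by rewrite gE eq_sym (negPf jk) mulr0 mul0r.
exists (fun k => A (g k)); split.
- by move=> k; exists (g k).
- move=> a a0 k.
  have ac0 : (fun x => \sum_k a k * (c k)%:C * E k x) = (fun=> 0) %[ae mu in Xi].
    apply: filterS a0 => x ax Xx; rewrite -[RHS](ax Xx); apply: eq_bigr => j _.
    by rewrite Ag// mulrA.
  have /eqP := waves_free ac0 k; rewrite mulf_eq0 => /orP[/eqP//|/eqP/complexI ck0].
  by have := c_gt0 k; rewrite ck0 ltxx.
- move=> _ [h Lh <-]; exists (fun k => ip h (E k)); apply: aeW => x Xx.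
  by rewrite wave_operatorE//; apply: eq_bigr => k _; rewrite Ag//; ring.
Qed.

End plane_wave_operator.

Lemma has_dim_unique (R : realType) (n : nat) (D : set 'rV[R]_n)
  (V : set ('rV[R]_n -> R[i])) p q : has_dim D V p -> has_dim D V q -> p = q.
Proof.
move=> Dp Dq; have [ep [Vp fp _]] := Dp; have [eq [Vq fq _]] := Dq.
apply/eqP; rewrite eqn_leq.
by rewrite (has_dim_free_le Dq Vp fp) (has_dim_free_le Dp Vq fq).
Qed.

Theorem theorem7p1 (R : realType) (d : nat) (hd : (1 <= d)%N)
    (Xi Upsilon Omega : set 'rV[R]_d)
    (XiUpsilon : Xi = Upsilon)
    (Xi_neq0 : Xi !=set0) (Xi_open : open Xi)
    (Xi_bounded : bounded_set Xi) (Xi_connected : connected Xi)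
    (OmegaE : Omega = [set x - y | x in Xi & y in Upsilon])
    (f : 'rV[R]_d -> R[i]) (f_L2 : L2 Omega f) (K : nat) :
  psd Xi (trunc_conv f Upsilon) /\ has_rank Upsilon Xi (trunc_conv f Upsilon) K
  <->
  exists (xi : 'I_K -> 'rV[R]_d) (c : 'I_K -> R),
    [/\ injective xi, forall k, 0 < c k &
        f = (fun x => \sum_k (c k)%:C * cexp ('i%C * (dotp (xi k) x)%:C))
          %[ae lebesgue_rV R d in Omega]].
Proof.
subst Upsilon Omega; split => [[Apsd rkA]|[xi [c [ixi c0 fw]]]]; last first.
  have {}fw : f = (fun x => \sum_k (c k)%:C * plane_wave (xi k) x)
      %[ae lebesgue_rV R d in [set x - y | x in Xi & y in Xi]].
    apply: filterS fw => x fx Ox; rewrite fx//; apply: eq_bigr => k _.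
    by rewrite cexpi.
  by split; [apply: plane_waves_psd fw|apply: plane_waves_rank fw].
have [m [xi0 [w fw]]] := psd_finite_rank_waves Xi_open Xi_neq0 Xi_bounded
  Xi_connected f_L2 Apsd rkA.
have wE k : w k * (w k)^* = (complex.Re (w k) ^+ 2 + complex.Im (w k) ^+ 2)%:C.
  by apply: complex_ext; rewrite ?ReM ?ImM Re_conj Im_conj /=; ring.
have [|p [xi [c [ixi c0 sumE]]]] := merge_frequencies xi0
    (r := fun k => complex.Re (w k) ^+ 2 + complex.Im (w k) ^+ 2).
  by move=> k; rewrite addr_ge0 ?sqr_ge0.
have {}fw : f = (fun x => \sum_k (c k)%:C * plane_wave (xi k) x)
    %[ae lebesgue_rV R d in [set x - y | x in Xi & y in Xi]].
  apply: filterS fw => x fx Ox; rewrite fx// -(sumE (fun t => plane_wave t x)).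
  by apply: eq_bigr => k _; rewrite wE.
have Kp : K = p.
  apply: has_dim_unique rkA _.
  exact: (plane_waves_rank Xi_open Xi_neq0 Xi_bounded f_L2 ixi c0 fw).
subst p; exists xi, c; split => //.
apply: filterS fw => x fx Ox; rewrite fx//; apply: eq_bigr => k _.
by rewrite cexpi.
Qed.
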